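(* Let $(A,\mu,E,\Delta,\epsilon)$ be a regular weak multiplier bialgebra over a field. There is a bijective correspondence between the following data: (1) linear maps $R_1,R_2:A\otimes A\to A\otimes A$ such that $R_iT_i=G_i$, $T_iR_i=E_i$ and $R_iT_iR_i=R_i$ for $i\in\{1,2\}$; (2) linear maps $S:A\to\mathbb M(A)$ satisfying, for all $a,b,c\in A$, (vii) $T_1\big[((\mathrm{id}\otimes S)T_2(a\otimes b))(1\otimes c)\big]=\Delta(a)(b\otimes c)$, (viii) $T_2\big[(a\otimes1)((S\otimes\mathrm{id})T_1(b\otimes c))\big]=(a\otimes b)\Delta(c)$, (ix) $\mu(S\otimes\mathrm{id})[E(a\otimes1)]=S(a)$ (equivalently, $\mu(\mathrm{id}\otimes S)[(1\otimes a)E]=S(a)$).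
   Context: Let $k$ be a field; $\langle X\rangle$ is linear span; $\mathsf{tw}(x\otimes y)=y\otimes x$. A non-unital $k$-algebra $A$ is idempotent if its multiplication $\mu$ is surjective and has non-degenerate multiplication if ($ab=0\ \forall a$)$\Rightarrow b=0$ and ($ba=0\ \forall a$)$\Rightarrow b=0$. $\mathbb M(A)$ is its multiplier algebra (pairs $(\lambda,\rho)$ of linear maps $A\to A$ with $a\lambda(b)=\rho(a)b$), a unital algebra containing $A$ as a dense ideal; $A\otimes A\subseteq\mathbb M(A)\otimes\mathbb M(A)\subseteq\mathbb M(A\otimes A)$; $\mu$ also denotes multiplication of $\mathbb M(A)$. Multiplicative $\gamma:A\to\mathbb M(B)$ with idempotent $e\in\mathbb M(B)$, $\langle\gamma(a)b\rangle=eB$, $\langle b\gamma(a)\rangle=Be$ extends uniquely to multiplicative $\overline\gamma:\mathbb M(A)\to\mathbb M(B)$ with $\overline\gamma(1)=e$. A weak multiplier bialgebra: idempotent $A$ with non-degenerate multiplication, idempotent $E\in\mathbb M(A\otimes A)$, multiplicative linear $\Delta:A\to\mathbb M(A\otimes A)$, linear $\epsilon:A\to k$ with: (i) $T_1(a\otimes b):=\Delta(a)(1\otimes b)$, $T_2(a\otimes b):=(a\otimes1)\Delta(b)$ lie in $A\otimes A$; (ii) $(T_2\otimes\mathrm{id})(\mathrm{id}\otimes T_1)=(\mathrm{id}\otimes T_1)(T_2\otimes\mathrm{id})$; (iii) $(\epsilon\otimes\mathrm{id})T_1=\mu=(\mathrm{id}\otimes\epsilon)T_2$; (iv) $\langle\Delta(a)(b\otimes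 b')\rangle=\langle E(b\otimes b')\rangle$, $\langle(b\otimes b')\Delta(a)\rangle=\langle(b\otimes b')E\rangle$; (v) $(E\otimes1)(1\otimes E)=E^{(3)}=(1\otimes E)(E\otimes1)$ with $E^{(3)}:=(\overline{\mathrm{id}\otimes\Delta})(E)=(\overline{\Delta\otimes\mathrm{id}})(E)$; (vi) $(\epsilon\otimes\mathrm{id})((1\otimes a)E(b\otimes c))=(\epsilon\otimes\mathrm{id})(\Delta(a)(b\otimes c))$ and $(\epsilon\otimes\mathrm{id})((a\otimes b)E(1\otimes c))=(\epsilon\otimes\mathrm{id})((a\otimes b)\Delta(c))$. Regular: also $T_3(a\otimes b):=(1\otimes b)\Delta(a)$ and $T_4(a\otimes b):=\Delta(b)(a\otimes1)$ lie in $A\otimes A$. Multipliers for $a\in A$: $\overline\sqcap^L(a)$ with $\overline\sqcap^L(a)b=(\epsilon\otimes\mathrm{id})((a\otimes1)\Delta(b))$, $b\overline\sqcap^L(a)=(\epsilon\otimes\mathrm{id})((a\otimes b)E)$; $\overline\sqcap^R(a)$ with $b\overline\sqcap^R(a)=(\mathrm{id}\otimes\epsilon)(\Delta(b)(1\otimes a))$, $\overline\sqcap^R(a)b=(\mathrm{id}\otimes\epsilon)(E(b\otimes a))$. Maps $A\otimes A\to A\otimes A$: $E_1(a\otimes b)=E(a\otimes b)$; $E_2(a\otimes b)=(a\otimes b)E$; $G_1$ the well-defined linear map with $G_1(a\otimes bc)=(a\otimes1)\big((\overline\sqcap^R\otimes\mathrm{id})(\mathsf{tw}\,T_4(c\otimes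 b))\big)$; $G_2$ the well-defined linear map with $G_2(ab\otimes c)=\big((\mathrm{id}\otimes\overline\sqcap^L)(\mathsf{tw}\,T_3(b\otimes a))\big)(1\otimes c)$. In (vii)–(ix), $(\mathrm{id}\otimes S)$, $(S\otimes\mathrm{id})$ are applied to elements of $A\otimes A$, and $E(a\otimes1)\in A\otimes\mathbb M(A)$, $(1\otimes a)E\in\mathbb M(A)\otimes A$. *)

(* Defs.v *)
From HB Require Import structures.
From mathcomp Require Import all_boot all_algebra.
From mathcomp Require Import boolp functions.
Set Implicit Arguments. Unset Strict Implicit. Unset Printing Implicit Defensive.
Import GRing.Theory.
Local Open Scope ring_scope.

(* Algebraic tensor product U (x) V of two k-vector spaces, realised as the  *)
(* subspace of (U^* x V^* -> k) spanned by the elementary tensors            *)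
(* u (x) v : (f, g) |-> f u * g v.  (For vector spaces over a field the      *)
(* canonical map from the abstract tensor product onto this subspace is a    *)
(* linear isomorphism.)                                                      *)
Section Tensor.
Variables (k : fieldType) (U V : lmodType k).

Definition tform := {scalar U} -> {scalar V} -> k^o.
Definition tens_raw (u : U) (v : V) : tform := fun f g => f u * g v.
Definition is_tensor (x : tform) : Prop :=
  exists s : seq (U * V), x = \sum_(p <- s) tens_raw p.1 p.2.
Definition tensor_pred : pred tform := fun x => `[< is_tensor x >].

Lemma tensor_closed : subsemimod_closed tensor_pred.
Proof.
split; [split|].
- by apply/asboolP; exists [::]; rewrite big_nil.
- move=> x y /asboolP [s ->] /asboolP [t ->]; apply/asboolP; exists (s ++ t).
  by rewrite big_cat.
- move=> a x /asboolP [s ->]; apply/asboolP.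
  exists [seq (a *: p.1, p.2) | p <- s]; rewrite big_map scaler_sumr.
  apply: eq_bigr => p _ /=; apply/funext => f; apply/funext => g.
  by rewrite /tens_raw /= linearZ /= -mulrA.
Qed.

Record tensor := Tensor { tval : tform; tvalP : tensor_pred tval }.
HB.instance Definition _ := [isSub for tval].
HB.instance Definition _ := [Choice of tensor by <:].
HB.instance Definition _ :=
  GRing.SubChoice_isSubLmodule.Build _ _ _ tensor tensor_closed.

Definition tens (u : U) (v : V) : tensor.
Proof.
refine (@Tensor (tens_raw u v) _); apply/asboolP; exists [:: (u, v)].
by rewrite big_seq1.
Defined.

Definition tdecomp (t : tensor) : seq (U * V) :=
  projT1 (cid (elimT (asboolP _) (tvalP t))).

(* The linear map U (x) V -> W induced by a map F : U -> V -> W; it is the  *)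
(* map given by the universal property whenever F is bilinear (which is the *)
(* only way it is used below).                                               *)
Definition tlift (W : lmodType k) (F : U -> V -> W) (t : tensor) : W :=
  \sum_(p <- tdecomp t) F p.1 p.2.
End Tensor.

Arguments tens {k U V}.

Section TensorMaps.
Variable (k : fieldType).

Definition tmap (U V U' V' : lmodType k) (f : U -> U') (g : V -> V')
  : tensor U V -> tensor U' V' := tlift (fun x y => tens (f x) (g y)).

Definition tw (U V : lmodType k) : tensor U V -> tensor V U :=
  tlift (fun x y => tens y x).

Definition assocL (U V W : lmodType k) :
  tensor (tensor U V) W -> tensor U (tensor V W) :=
  tlift (fun t w => tlift (fun u v => tens u (tens v w)) t).
Definition assocR (U V W : lmodType k) :
  tensor U (tensor V W) -> tensor (tensor U V) W :=
  tlift (fun u t => tlift (fun v w => tens (tens u v) w) t).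

Definition lin (U W : lmodType k) (f : U -> W) :=
  forall a x y, f (a *: x + y) = a *: f x + f y.

Definition span (W : lmodType k) (X : W -> Prop) : W -> Prop :=
  fun w => exists s : seq (k * W),
    (forall p, p \in s -> X p.2) /\ w = \sum_(p <- s) p.1 *: p.2.

Definition same_set (W : Type) (X Y : W -> Prop) := forall w, X w <-> Y w.
End TensorMaps.

Section Algebras.
Variables (k : fieldType).

Definition nu_algebra (V : lmodType k) (m : V -> V -> V) :=
  [/\ forall a, lin (m a), forall b, lin (m^~ b) & associative m].

Definition tmu (V : lmodType k) (m : V -> V -> V) : tensor V V -> V := tlift m.

Definition idempotent_alg (V : lmodType k) (m : V -> V -> V) :=
  forall x : V, exists t : tensor V V, tmu m t = x.

Definition nondegenerate (V : lmodType k) (m : V -> V -> V) :=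
  (forall b, (forall a, m a b = 0) -> b = 0) /\
  (forall b, (forall a, m b a = 0) -> b = 0).

(* A multiplier is a pair (lambda, rho): lambda b = "x b", rho a = "a x". *)
Definition mult (V : lmodType k) := ((V -> V) * (V -> V))%type.

Definition is_mult (V : lmodType k) (m : V -> V -> V) (x : mult V) :=
  [/\ lin x.1, lin x.2 & forall a b, m a (x.1 b) = m (x.2 a) b].

Definition mmul (V : lmodType k) (x y : mult V) : mult V :=
  (x.1 \o y.1, y.2 \o x.2).
Definition mone (V : lmodType k) : mult V := (id, id).
Definition memb (V : lmodType k) (m : V -> V -> V) (a : V) : mult V :=
  (m a, fun b => m b a).

Definition mlin (U V : lmodType k) (f : U -> mult V) :=
  (forall y, lin (fun x => (f x).1 y)) /\ (forall y, lin (fun x => (f x).2 y)).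

Definition is_extension (A B : lmodType k) (mA : A -> A -> A) (mB : B -> B -> B)
  (gamma : A -> mult B) (e : mult B) (gb : mult A -> mult B) :=
  [/\ forall x, is_mult mA x -> is_mult mB (gb x),
      forall x y, is_mult mA x -> is_mult mA y -> gb (mmul x y) = mmul (gb x) (gb y),
      gb (mone A) = e
    & forall a, gb (memb mA a) = gamma a].
End Algebras.

Section WMBA.
Variables (k : fieldType) (A : lmodType k) (mul : A -> A -> A).

Notation AA := (tensor A A).
Notation AAA := (tensor (tensor A A) A).

Definition mul2 (x y : AA) : AA :=
  tlift (fun a b => tlift (fun c d => tens (mul a c) (mul b d)) y) x.
Definition mul3 (x y : AAA) : AAA :=
  tlift (fun a b => tlift (fun c d => tens (mul2 a c) (mul b d)) y) x.

Definition one_t (b : A) : mult AA := (tmap id (mul b), tmap id (mul^~ b)).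
Definition t_one (a : A) : mult AA := (tmap (mul a) id, tmap (mul^~ a) id).

Definition mr (X : mult AA) (n : mult A) : mult AAA :=
  (tmap X.1 n.1, tmap X.2 n.2).
Definition ml (n : mult A) (X : mult AA) : mult AAA :=
  (@assocR _ A A A \o tmap n.1 X.1 \o @assocL _ A A A,
   @assocR _ A A A \o tmap n.2 X.2 \o @assocL _ A A A).

Definition epsl (eps : A -> k^o) : AA -> A := tlift (fun x y => eps x *: y).
Definition epsr (eps : A -> k^o) : AA -> A := tlift (fun x y => eps y *: x).

Variables (E : mult AA) (Delta : A -> mult AA) (eps : A -> k^o).

Definition id_Delta (t : AA) : mult AAA :=
  (fun y => tlift (fun a b => (ml (memb mul a) (Delta b)).1 y) t,
   fun y => tlift (fun a b => (ml (memb mul a) (Delta b)).2 y) t).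
Definition Delta_id (t : AA) : mult AAA :=
  (fun y => tlift (fun a b => (mr (Delta a) (memb mul b)).1 y) t,
   fun y => tlift (fun a b => (mr (Delta a) (memb mul b)).2 y) t).

Variables (T1 T2 T3 T4 : AA -> AA).

Definition wmb_bialgebra :=
  [/\ [/\ nu_algebra mul, idempotent_alg mul & nondegenerate mul],
      [/\ is_mult mul2 E /\ mmul E E = E,
          forall a, is_mult mul2 (Delta a), mlin Delta,
          (forall a b, Delta (mul a b) = mmul (Delta a) (Delta b)) & lin eps],
      [/\ lin T1, lin T2,
          forall a b, memb mul2 (T1 (tens a b)) = mmul (Delta a) (one_t b)
        & forall a b, memb mul2 (T2 (tens a b)) = mmul (t_one a) (Delta b)],
      tmap T2 id \o (@assocR _ A A A \o tmap id T1 \o @assocL _ A A A)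
        = (@assocR _ A A A \o tmap id T1 \o @assocL _ A A A) \o tmap T2 id &
      [/\
          epsl eps \o T1 = tmu mul /\ epsr eps \o T2 = tmu mul,
          same_set (span (fun z => exists a b b', z = (Delta a).1 (tens b b')))
                   (span (fun z => exists b b', z = E.1 (tens b b'))) /\
          same_set (span (fun z => exists a b b', z = (Delta a).2 (tens b b')))
                   (span (fun z => exists b b', z = E.2 (tens b b'))),
          exists E3 : mult AAA,
            [/\ (exists gb, is_extension mul2 mul3 id_Delta (ml (mone A) E) gb
                             /\ gb E = E3),
                (exists gb, is_extension mul2 mul3 Delta_id (mr E (mone A)) gb
                             /\ gb E = E3),
                mmul (mr E (mone A)) (ml (mone A) E) = E3
              & E3 = mmul (ml (mone A) E) (mr E (mone A))]
        &
          (forall a b c, epsl eps ((one_t a).1 (E.1 (tens b c)))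
                         = epsl eps ((Delta a).1 (tens b c))) /\
          (forall a b c, epsl eps ((one_t c).2 (E.2 (tens a b)))
                         = epsl eps ((Delta c).2 (tens a b)))]].

Definition regular_wmb_bialgebra :=
  [/\ wmb_bialgebra, lin T3, lin T4,
      forall a b, memb mul2 (T3 (tens a b)) = mmul (one_t b) (Delta a)
    & forall a b, memb mul2 (T4 (tens a b)) = mmul (Delta b) (t_one a)].

Definition PiL (a : A) : mult A :=
  (fun b => epsl eps (T2 (tens a b)), fun b => epsl eps (E.2 (tens a b))).
Definition PiR (a : A) : mult A :=
  (fun b => epsr eps (E.1 (tens b a)), fun b => epsr eps (T1 (tens b a))).

Definition is_G1 (G1 : AA -> AA) :=
  lin G1 /\ forall a b c, G1 (tens a (mul b c))
    = tlift (fun x y => tens ((PiR x).2 a) y) (tw (T4 (tens c b))).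
Definition is_G2 (G2 : AA -> AA) :=
  lin G2 /\ forall a b c, G2 (tens (mul a b) c)
    = tlift (fun x y => tens x ((PiL y).1 c)) (tw (T3 (tens b a))).

Definition data_R (G1 G2 : AA -> AA) (R : (AA -> AA) * (AA -> AA)) :=
  [/\ lin R.1, lin R.2,
      [/\ R.1 \o T1 = G1, T1 \o R.1 = E.1 & R.1 \o T1 \o R.1 = R.1]
    & [/\ R.2 \o T2 = G2, T2 \o R.2 = E.2 & R.2 \o T2 \o R.2 = R.2]].

Definition data_S (S : A -> mult A) :=
  [/\ (forall a, is_mult mul (S a)) /\ mlin S,
      forall a b c,
        T1 (tlift (fun x y => tens x ((S y).1 c)) (T2 (tens a b)))
        = (Delta a).1 (tens b c),
      forall a b c,
        T2 (tlift (fun x y => tens ((S x).2 a) y) (T1 (tens b c)))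
        = (Delta c).2 (tens a b)
    & (* (ix)  mu(S(x)id)[E(a(x)1)] = S(a), tested against every d in A:
         (mu(S(x)id)[E(a(x)1)]) d = mu(S(x)id)[E(a(x)d)] = S(a) d *)
      forall a d, tlift (fun x y => (S x).1 y) (E.1 (tens a d)) = (S a).1 d].
End WMBA.

(* Main.v *)
(* In Sweedler notation the maps are
     R_1(a (x) b) = a_1 (x) S(a_2) b,   R_2(a (x) b) = a S(b_1) (x) b_2,
   so that S(a) b = (eps (x) id) R_1(a (x) b) and a S(b) = (id (x) eps) R_2(a (x) b).
   Both kinds of data are unique when they exist:
   - R_i T_i = G_i, T_i R_i = E_i and R_i T_i R_i = R_i make R_i a generalized
     inverse of T_i with prescribed idempotents;
   - by (ix) and (viii), c S(a) d = (id (x) eps)((c (x) p) Delta(q)), summed over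
     any sum of p (x) q in A (x) A whose image under T_1 is E(a (x) d).
   It therefore suffices to produce one kind of data from the other.
   Given R_1 and R_2, the maps R_2 (x) id and id (x) R_1 commute on A (x) A (x) A,
   because they are generalized inverses of commuting maps whose idempotents
   commute with the maps acting on the other pair of legs; this commutation makes
   S(a) a multiplier.
   Given S, (vii) puts the range of E_1 inside that of T_1, and (viii) yields
   ((id (x) S)T_2(a (x) -))(1 (x) -) o T_1 = (a (x) 1) G_1(-), so that G_1 factors
   through T_1; R_1 is G_1 after any section of T_1 after E_1.
   Passing to the opposite algebra with the coopposite comultiplication gives
   the statements about R_2. *)

Require Import Defs.
From HB Require Import structures.
From mathcomp Require Import all_boot all_algebra.
From mathcomp Require Import boolp classical_sets functions.
Import GRing.Theory.
Set Implicit Arguments. Unset Strict Implicit. Unset Printing Implicit Defensive.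
Local Open Scope ring_scope.

(** * Separating linear forms *)

Section Separation.
Variables (k : fieldType) (V : lmodType k).

Definition subspace (M : V -> Prop) :=
  M 0 /\ forall c x y, M x -> M y -> M (c *: x + y).

(** Zorn's lemma; a maximal [M] complements the line through [u], because a vector outside [M + k u]
    could be adjoined to [M] without reaching [u]. *)
Lemma maximal_subspace_avoiding (M0 : V -> Prop) (u : V) :
  subspace M0 -> ~ M0 u ->
  exists M : V -> Prop, [/\ subspace M, forall x, M0 x -> M x, ~ M u &
    forall v, exists c, M (v - c *: u)].
Proof.
move=> subM0 M0u.
pose P (M : set V) := M = set0 \/ [/\ subspace M, forall x, M0 x -> M x & ~ M u].
have [|M [PM maxM]] := @Zorn_bigcup V P.
- move=> F FP Ftot.
  have [[X FX [x Xx]]|F0] := pselect (exists2 X, F X & exists x, X x); last first.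
    left; apply/seteqP; split=> // x [X FX Xx]; case: F0; exists X => //.
    by exists x.
  right.
  have good Y y : F Y -> Y y ->
      [/\ subspace Y, forall x, M0 x -> Y x & ~ Y u].
    by move=> FY Yy; case: (FP _ FY) => // Y0; rewrite Y0 in Yy.
  have [[X0 Xl] XM Xu] := good _ _ FX Xx; split.
  + split; first by exists X.
    move=> c y z [Y FY Yy] [Z FZ Zz].
    case: (Ftot _ _ FY FZ) => YZ.
      by exists Z => //; have [[_ h] _ _] := good _ _ FZ Zz; apply: h => //; apply: YZ.
    by exists Y => //; have [[_ h] _ _] := good _ _ FY Yy; apply: h => //; apply: YZ.
  + by move=> y /XM; exists X.
  + by move=> [Y FY Yu]; have [_ _ /(_ Yu)] := good _ _ FY Yu.
- have {PM} [subM MM0 Mu] : [/\ subspace M, forall x, M0 x -> M x & ~ M u].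
    case: PM => // M_0; exfalso; apply: (maxM M0); last by right.
    rewrite M_0; split=> // /(_ 0); apply; exact: subM0.1.
  exists M; split=> // v.
  apply: contrapT => /forallNP nMv.
  have Mv : ~ M v by move=> Mv; apply: (nMv 0); rewrite scale0r subr0.
  (* [N] is [M + k v]. If [u - c v] were in [M], then [c = 0] would put [u] in [M], and otherwise
     [v - c^-1 u] would lie in [M]; both are excluded. *)
  pose N : set V := fun x => exists c, M (x - c *: v).
  have MN x : M x -> N x by move=> Mx; exists 0; rewrite scale0r subr0.
  have Mlin := subM.2.
  apply: (maxM N).
    split=> // /(_ v) NM; apply: Mv; apply: NM; exists 1.
    by rewrite scale1r subrr; exact: subM.1.
  right; split.
  + split; first exact/MN/subM.1.
    move=> c x y [a Mx] [b My]; exists (c * a + b).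
    suff -> : c *: x + y - (c * a + b) *: v = c *: (x - a *: v) + (y - b *: v).
      exact: Mlin.
    by rewrite scalerBr scalerDl scalerA opprD addrACA.
  + by move=> x /MM0/MN.
  + case=> c Muv; have [c0|c0] := eqVneq c 0.
      by rewrite c0 scale0r subr0 in Muv.
    apply: (nMv c^-1).
    have := Mlin (- c^-1) _ _ Muv subM.1.
    by rewrite addr0 scalerBr !scaleNr opprK scalerA mulVf // scale1r addrC.
Qed.

Section Coefficient.
Variables (M : V -> Prop) (u : V).
Hypotheses (subM : subspace M) (Mu : ~ M u).
Hypothesis decomp : forall v, exists c, M (v - c *: u).

(** The coordinate along [u] modulo [M], chosen classically. It is unique because [u] is outside
    [M], and uniqueness makes it linear. *)
Definition coefficient (v : V) : k^o := projT1 (cid (decomp v)).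

Lemma coefficientE c v : M (v - c *: u) -> coefficient v = c.
Proof.
move=> Mc; have := projT2 (cid (decomp v)); rewrite -/(coefficient v).
set d := coefficient v => Md; apply: contrapT => /eqP dc.
have dc0 : d - c != 0 by rewrite subr_eq0.
apply: Mu; rewrite -[u]scale1r -(mulVf dc0).
have := subM.2 _ _ _ (subM.2 (-1) _ _ Md Mc) subM.1.
move=> /(_ (d - c)^-1); rewrite addr0 scaleN1r opprB addrC addrA subrK.
by rewrite addrC -scalerBl scalerA.
Qed.

Lemma coefficient_linear : linear coefficient.
Proof.
move=> a x y.
have Mx := projT2 (cid (decomp x)); have My := projT2 (cid (decomp y)).
rewrite -/(coefficient x) -/(coefficient y) in Mx My.
apply: coefficientE; have := subM.2 a _ _ Mx My.
by rewrite scalerBr addrACA -opprD scalerA scalerDl.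
Qed.

HB.instance Definition _ :=
  GRing.isLinear.Build k V k^o *%R coefficient coefficient_linear.

Definition coefficient_form : {scalar V} := coefficient.
End Coefficient.

Lemma separating_form (M : V -> Prop) (u : V) : subspace M -> ~ M u ->
  exists f : {scalar V}, f u = 1 /\ forall x, M x -> f x = 0.
Proof.
move=> subM Mu.
have [N [subN MN Nu dec]] := maximal_subspace_avoiding subM Mu.
exists (coefficient_form subN Nu dec); split=> [|x Mx]; apply: coefficientE => //.
  by rewrite scale1r subrr; exact: subN.1.
by rewrite scale0r subr0; apply: MN.
Qed.

Lemma form_eq0 (v : V) : (forall f : {scalar V}, f v = 0) -> v = 0.
Proof.
move=> fv; apply: contrapT => v0.
have [|//|f [fv1 _]] := @separating_form (fun x => x = 0) v.
  by split=> // c x y -> ->; rewrite scaler0 addr0.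
by have := fv f; rewrite fv1 => /eqP; rewrite oner_eq0.
Qed.
End Separation.

(** * Linear maps out of tensor products *)

Section Lin.
Variable k : fieldType.
Implicit Types U V W : lmodType k.

Lemma lin0 U V (f : U -> V) : lin f -> f 0 = 0.
Proof. by move=> fl; have := fl (-1) 0 0; rewrite scaler0 addr0 scaleN1r addNr. Qed.

Lemma linD U V (f : U -> V) : lin f -> {morph f : x y / x + y}.
Proof. by move=> fl x y; rewrite -[x]scale1r fl !scale1r. Qed.

Lemma linZ U V (f : U -> V) : lin f -> forall c, {morph f : x / c *: x}.
Proof. by move=> fl c x; rewrite -[c *: x]addr0 fl (lin0 fl) addr0. Qed.

Lemma lin_sum U V (f : U -> V) I (r : seq I) (F : I -> U) : lin f ->
  f (\sum_(i <- r) F i) = \sum_(i <- r) f (F i).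
Proof.
move=> fl; elim: r => [|i r IH]; first by rewrite !big_nil lin0.
by rewrite !big_cons linD // IH.
Qed.

Lemma lin_id U : lin (fun x : U => x). Proof. by []. Qed.

Lemma lin_comp U V W (g : V -> W) (f : U -> V) :
  lin g -> lin f -> lin (fun x => g (f x)).
Proof. by move=> gl fl a x y; rewrite fl gl. Qed.

Lemma lin_scale U V (c : k) (f : U -> V) : lin f -> lin (fun x => c *: f x).
Proof. by move=> fl a x y; rewrite fl scalerDr !scalerA mulrC. Qed.

Lemma lin_scalel U V (f : U -> k^o) (v : V) : lin f -> lin (fun x => (f x : k) *: v).
Proof. by move=> fl a x y; rewrite fl scalerDl scalerA. Qed.

Lemma lin_bigsum U V I (r : seq I) (F : I -> U -> V) :
  (forall i, lin (F i)) -> lin (fun x => \sum_(i <- r) F i x).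
Proof.
move=> Fl a x y; rewrite scaler_sumr -big_split; apply: eq_bigr => i _.
exact: Fl.
Qed.

Definition bil U V W (F : U -> V -> W) :=
  (forall x, lin (F x)) /\ (forall y, lin (fun x => F x y)).
End Lin.

(** * Universal property of the tensor product *)

Section TensorTheory.
Variables (k : fieldType).
Implicit Types U V W : lmodType k.

(* If the first vector u of the list depends on the others, it is absorbed into
   them by bilinearity; otherwise a form equal to 1 at u and vanishing on the
   others shows that the second component of its entry is 0. *)
Lemma bilinear_sum_eq0 U V W (F : U -> V -> W) (s : seq (U * V)) : bil F ->
  (forall (f : {scalar U}) (g : {scalar V}),
     \sum_(p <- s) (f p.1 : k) * g p.2 = 0) ->
  \sum_(p <- s) F p.1 p.2 = 0.
Proof.
move=> [Fr Fl]; move: {2}(size s).+1 (ltnSn (size s)) => n.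
elim: n s => // n IH [|[u v] s]; first by rewrite big_nil.
rewrite ltnS /= => sn s0.
pose m := size s; pose p0 : U * V := (0, 0).
pose M x := exists d : 'I_m -> k, x = \sum_(i < m) d i *: (nth p0 s i).1.
have [Mu|nMu] := pselect (M u).
  have [d ud] := Mu.
  pose s' := [seq ((nth p0 s i).1, (nth p0 s i).2 + d i *: v) | i : 'I_m <- enum 'I_m].
  have sE (W' : lmodType k) (G : U -> V -> W') : bil G ->
      \sum_(p <- (u, v) :: s) G p.1 p.2 = \sum_(p <- s') G p.1 p.2.
    move=> [Gr Gl]; rewrite big_cons big_map big_enum /= (big_nth p0) big_mkord.
    have -> : G u v = \sum_(i < m) G (nth p0 s i).1 (d i *: v).
      rewrite ud (lin_sum _ _ (Gl v)); apply: eq_bigr => i _.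
      by rewrite (linZ (Gl v)) (linZ (Gr _)).
    rewrite -big_split; apply: eq_bigr => i _ /=.
    by rewrite (linD (Gr _)) addrC.
  rewrite sE //; apply: IH.
    by rewrite size_map size_enum_ord.
  move=> f g; rewrite -(sE k^o (fun x y => (f x : k) * g y)); last first.
    split=> [x|y] a z w.
      by rewrite linearP /= mulrDr; congr (_ + _); rewrite /= mulrCA.
    by rewrite linearP /= mulrDl; congr (_ + _); rewrite /= -mulrA.
  exact: s0.
have subM : subspace M.
  split; first by exists (fun=> 0); rewrite big1 // => i _; rewrite scale0r.
  move=> c x y [d ->] [e ->]; exists (fun i => c * d i + e i).
  rewrite scaler_sumr -big_split; apply: eq_bigr => i _ /=.
  by rewrite scalerDl scalerA.
have [f [fu fM]] := separating_form subM nMu.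
have fs p : p \in s -> f p.1 = 0.
  move=> ps; apply: fM; have im : (index p s < m)%N by rewrite index_mem.
  exists (fun i => (i == Ordinal im)%:R); rewrite (bigD1 (Ordinal im)) //=.
  by rewrite eqxx scale1r nth_index // big1 ?addr0 // => i /negPf->; rewrite scale0r.
have v0 : v = 0.
  apply: form_eq0 => g; have := s0 f g; rewrite big_cons /= fu mul1r.
  by rewrite big_seq big1 ?addr0 // => p /fs ->; rewrite mul0r.
rewrite big_cons /= v0 (lin0 (Fr u)) add0r; apply: IH => // f' g.
by have := s0 f' g; rewrite big_cons /= v0 linear0 mulr0 add0r.
Qed.

Lemma tvalE U V (t : tensor U V) f g :
  Defs.tval t f g = \sum_(p <- tdecomp t) (f p.1 : k) * g p.2.
Proof.
rewrite /tdecomp; case: cid => s /= ->; elim: s => [|p s IH].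
  by rewrite !big_nil.
by rewrite !big_cons -IH.
Qed.

Lemma tens_sum U V (t : tensor U V) : t = \sum_(p <- tdecomp t) tens p.1 p.2.
Proof.
apply: val_inj => /=; rewrite {1}(projT2 (cid (elimT (asboolP _) (tvalP t)))).
rewrite -/(tdecomp t); elim: (tdecomp t) => [|p s IH]; first by rewrite !big_nil.
by rewrite !big_cons IH.
Qed.

Lemma tval_sum U V (s : seq (U * V)) f g :
  Defs.tval (\sum_(p <- s) tens p.1 p.2) f g = \sum_(p <- s) (f p.1 : k) * g p.2.
Proof.
by elim: s => [|p s IH]; rewrite ?big_nil // !big_cons -IH.
Qed.

(** [tdecomp] picks some expression of a tensor, and the value must not depend on the choice. The
    chosen list followed by the given one with signs reversed represents zero, so [bilinear_sum_eq0]
    applies. *)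
Lemma tlift_sum U V W (F : U -> V -> W) (s : seq (U * V)) : bil F ->
  tlift F (\sum_(p <- s) tens p.1 p.2) = \sum_(p <- s) F p.1 p.2.
Proof.
move=> bF; have [Fr Fl] := bF; rewrite /tlift; set t := \sum_(p <- s) _.
pose s' := [seq (- p.1, p.2) | p <- s].
have sN (W' : lmodType k) (G : U -> V -> W') : bil G ->
    \sum_(p <- s') G p.1 p.2 = - \sum_(p <- s) G p.1 p.2.
  move=> [_ Gl]; rewrite big_map -sumrN; apply: eq_bigr => p _ /=.
  by rewrite -scaleN1r (linZ (Gl _)) scaleN1r.
apply/eqP; rewrite -subr_eq0 -sN // -big_cat; apply/eqP.
apply: bilinear_sum_eq0 => // f g; rewrite big_cat /=.
rewrite (sN k^o (fun x y => (f x : k) * g y)); last first.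
  split=> [x|y] a z w.
    by rewrite linearP /= mulrDr; congr (_ + _); rewrite /= mulrCA.
  by rewrite linearP /= mulrDl; congr (_ + _); rewrite /= -mulrA.
by rewrite -tvalE -tval_sum subrr.
Qed.

Lemma tliftE U V W (F : U -> V -> W) u v : bil F -> tlift F (tens u v) = F u v.
Proof.
by move=> bF; have := tlift_sum [:: (u, v)] bF; rewrite !big_seq1.
Qed.

Lemma bil_tens U V : bil (@tens k U V).
Proof.
split=> [u|v] a x y; apply: val_inj; apply/funext => f; apply/funext => g /=.
  by rewrite /tens_raw linearP /= mulrDr; congr (_ + _); rewrite /= mulrCA.
by rewrite /tens_raw linearP /= mulrDl; congr (_ + _); rewrite /= -mulrA.
Qed.

Lemma lin_tlift U V W (F : U -> V -> W) : bil F -> lin (tlift F).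
Proof.
move=> bF a x y; rewrite [in LHS](tens_sum x) [in LHS](tens_sum y).
rewrite /(tlift F x) /(tlift F y).
rewrite !scaler_sumr.
have -> : \sum_(p <- tdecomp x) a *: tens p.1 p.2 + \sum_(p <- tdecomp y) tens p.1 p.2
  = \sum_(p <- [seq (a *: p.1, p.2) | p <- tdecomp x] ++ tdecomp y) tens p.1 p.2.
  rewrite big_cat big_map; congr (_ + _); apply: eq_bigr => p _ /=.
  by rewrite (linZ ((bil_tens U V).2 p.2)).
rewrite tlift_sum // big_cat big_map; congr (_ + _); apply: eq_bigr => p _ /=.
by rewrite (linZ (bF.2 p.2)).
Qed.

Lemma lin_expand U V W (f : tensor U V -> W) t : lin f ->
  f t = tlift (fun u v => f (tens u v)) t.
Proof. by move=> fl; rewrite {1}(tens_sum t) lin_sum. Qed.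

Lemma tensor_ext U V W (f g : tensor U V -> W) : lin f -> lin g ->
  (forall u v, f (tens u v) = g (tens u v)) -> f =1 g.
Proof.
move=> fl gl fg t; rewrite (lin_expand t fl) (lin_expand t gl).
by apply: eq_bigr => p _.
Qed.

Lemma lin_through U V W W' (g : W -> W') (F : U -> V -> W) t : lin g ->
  g (tlift F t) = tlift (fun u v => g (F u v)) t.
Proof. by move=> gl; rewrite /tlift lin_sum. Qed.

Lemma eq_tlift U V W (F G : U -> V -> W) t :
  (forall u v, F u v = G u v) -> tlift F t = tlift G t.
Proof. by move=> FG; apply: eq_bigr. Qed.

(** Fubini for the finite sums over the two chosen decompositions. *)
Lemma tlift_exchange U V U' V' W (F : U -> V -> U' -> V' -> W) t s :
  tlift (fun u v => tlift (F u v) s) t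
  = tlift (fun u' v' => tlift (fun u v => F u v u' v') t) s.
Proof. exact: exchange_big. Qed.

Lemma lin_tlift_param U V W W' (F : W -> U -> V -> W') t :
  (forall u v, lin (fun x => F x u v)) -> lin (fun x => tlift (F x) t).
Proof. by move=> Fl; apply: (@lin_bigsum _ _ _ _ _ (fun p x => F x p.1 p.2)). Qed.

Lemma form_eval_lin U (f : {scalar U}) : @lin k U k^o f.
Proof. by move=> a x y; rewrite linearP. Qed.
End TensorTheory.

Create HintDb linear discriminated.
#[export] Hint Constants Opaque : linear.

Lemma lin_bil_l (k : fieldType) (U V W : lmodType k) (F : U -> V -> W) y :
  bil F -> lin (fun x => F x y).
Proof. by move=> [_ h]; exact: h. Qed.

Lemma lin_bil_r (k : fieldType) (U V W : lmodType k) (F : U -> V -> W) x :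
  bil F -> lin (fun y => F x y).
Proof. by move=> [h _]; exact: h. Qed.

(* Decides linearity of terms in which the bound variable occurs exactly once
   in every summand, from the (bi)linearity facts found in the context and in
   the hint database. Ltac may bind ?g to a term containing the bound variable;
   the [apply] that follows then fails and the next alternative is tried. *)
Ltac linear_tac :=
  intros; cbn beta;
  lazymatch goal with
  | |- bil _ => first [solve [eauto 2 with linear nocore] | split; linear_tac]
  | |- lin (fun x => x) => exact (@lin_id _ _)
  | |- lin id => exact (@lin_id _ _)
  | |- lin (tens ?u) => exact ((bil_tens _ _).1 u)
  | |- lin (fun x => tens x ?v) => exact ((bil_tens _ _).2 v)
  | |- lin _ =>
    first
    [ solve [eauto 2 with linear nocore]
    | lazymatch goal with |- lin (fun x => tlift (fun u v => @?F x u v) ?t) =>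
        apply (@lin_tlift_param _ _ _ _ _ F t); linear_tac end
    | lazymatch goal with |- lin (fun x => tlift ?F (@?f x)) =>
        apply (@lin_comp _ _ _ _ (tlift F) f);
        [apply lin_tlift; linear_tac | linear_tac] end
    | lazymatch goal with |- lin (tlift ?F) => apply lin_tlift; linear_tac end
    | lazymatch goal with |- lin (tmap ?f ?g) => apply lin_tlift; linear_tac end
    | lazymatch goal with |- lin (fun x => ?c *: (@?f x)) =>
        apply (@lin_scale _ _ _ c f); linear_tac end
    | lazymatch goal with |- lin (fun x => (@?f x) *: ?c) =>
        apply (@lin_scalel _ _ _ f c); linear_tac end
    | lazymatch goal with |- lin (fun x => ?g (@?f x)) =>
        apply (@lin_comp _ _ _ _ g f); [linear_tac | linear_tac] end
    | lazymatch goal with |- lin (fun x => ?g (@?f x) ?c) =>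
        apply (@lin_comp _ _ _ _ (fun y => g y c) f);
        [first [ solve [eauto 2 with linear nocore]
               | exact ((bil_tens _ _).2 c)
               | apply lin_bil_l; linear_tac ]
        | linear_tac] end
    | lazymatch goal with |- lin (fun x => ?g (@?f x) ?c ?d) =>
        apply (@lin_comp _ _ _ _ (fun y => g y c d) f);
        [solve [eauto 2 with linear nocore] | linear_tac] end
    | lazymatch goal with |- lin (?g ?c) => apply lin_bil_r; linear_tac end ]
  end.

(** * Tensor products of maps, twist, associators and joint injectivity *)

Section TensorMapTheory.
Variables (k : fieldType).
Implicit Types U V W : lmodType k.

Lemma lin_tmap U V U' V' (f : U -> U') (g : V -> V') :
  lin f -> lin g -> lin (tmap f g).
Proof. by move=> fl gl; apply: lin_tlift; linear_tac. Qed.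

Lemma tmapE U V U' V' (f : U -> U') (g : V -> V') u v : lin f -> lin g ->
  tmap f g (tens u v) = tens (f u) (g v).
Proof. by move=> fl gl; rewrite /tmap tliftE //; linear_tac. Qed.

Lemma lin_tw U V : lin (@tw k U V).
Proof. by apply: lin_tlift; linear_tac. Qed.

Lemma twE U V (u : U) (v : V) : tw (tens u v) = tens v u.
Proof. by rewrite /tw tliftE //; linear_tac. Qed.

Lemma twK U V : cancel (@tw k U V) (@tw k V U).
Proof.
move=> t; have l := @lin_tw; apply: (tensor_ext (f := fun t => tw (tw t)) (g := id)).
- by linear_tac.
- by linear_tac.
by move=> u v; rewrite !twE.
Qed.

Lemma lin_assocL U V W : lin (@assocL k U V W).
Proof. by apply: lin_tlift; linear_tac. Qed.

Lemma lin_assocR U V W : lin (@assocR k U V W).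
Proof. by apply: lin_tlift; linear_tac. Qed.

Lemma assocLE U V W (u : U) (v : V) (w : W) :
  assocL (tens (tens u v) w) = tens u (tens v w).
Proof. by rewrite /assocL !tliftE //; linear_tac. Qed.

Lemma assocRE U V W (u : U) (t : tensor V W) :
  assocR (tens u t) = tlift (fun v w => tens (tens u v) w) t.
Proof. by rewrite /assocR tliftE //; linear_tac. Qed.

Lemma assocR_tens U V W (u : U) (v : V) (w : W) :
  assocR (tens u (tens v w)) = tens (tens u v) w.
Proof. by rewrite assocRE tliftE //; linear_tac. Qed.

Lemma tlift_tw U V W (F : V -> U -> W) (t : tensor U V) : bil F ->
  tlift F (tw t) = tlift (fun u v => F v u) t.
Proof.
move=> bF; rewrite /tw (lin_through _ _ (lin_tlift bF)).
by apply: eq_tlift => u v; rewrite tliftE.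
Qed.

Lemma tlift_tmap U V U' V' W (F : U' -> V' -> W) (f : U -> U') (g : V -> V') t :
  bil F -> tlift F (tmap f g t) = tlift (fun u v => F (f u) (g v)) t.
Proof.
move=> bF; rewrite /tmap (lin_through _ _ (lin_tlift bF)).
by apply: eq_tlift => u v; rewrite tliftE.
Qed.

Lemma tensor_eq0 U V (t : tensor U V) :
  (forall f g, Defs.tval t f g = 0) -> t = 0.
Proof. by move=> t0; apply: val_inj; apply/funext => f; apply/funext => g; apply: t0. Qed.

(** Contracting the second leg with a form [q] commutes with each map acting on the first leg, so
    the contracted vector is killed by all [f i] and vanishes; every evaluation of [t] is then
    zero. *)
Lemma tmap_left_jointly_injective I U V U' (f : I -> U -> U') (t : tensor U V) :
  (forall i, lin (f i)) -> (forall u, (forall i, f i u = 0) -> u = 0) ->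
  (forall i, tmap (f i) id t = 0) -> t = 0.
Proof.
move=> fl finj ft; apply: tensor_eq0 => p q.
have pl := form_eval_lin p; have ql := form_eval_lin q.
pose G W := fun (u : W) v => (q v : k) *: u.
have bG W : bil (@G W) by rewrite /G; linear_tac.
have -> : Defs.tval t p q = p (tlift (@G U) t).
  rewrite tvalE (lin_through _ _ pl); apply: eq_bigr => x _.
  by rewrite linearZ mulrC.
suff -> : tlift (@G U) t = 0 by exact: linear0.
apply: finj => i; rewrite (lin_through _ _ (fl i)).
have := congr1 (tlift (@G U')) (ft i).
rewrite tlift_tmap // (lin0 (lin_tlift (bG _))) => <-.
by apply: eq_tlift => u v; rewrite /G (linZ (fl i)).
Qed.

Lemma tmap_right_jointly_injective I U V V' (f : I -> V -> V') (t : tensor U V) :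
  (forall i, lin (f i)) -> (forall u, (forall i, f i u = 0) -> u = 0) ->
  (forall i, tmap id (f i) t = 0) -> t = 0.
Proof.
move=> fl finj ft; rewrite -[t]twK.
suff -> : tw t = 0 by apply: (lin0 (@lin_tw _ _)).
apply: (tmap_left_jointly_injective fl finj) => i.
rewrite /tmap tlift_tw; last by linear_tac.
have := congr1 (@tw _ _ _) (ft i); rewrite (lin0 (@lin_tw _ _)) => <-.
rewrite /tmap (lin_through _ _ (@lin_tw _ _)).
by apply: eq_tlift => u v; rewrite twE.
Qed.
End TensorMapTheory.
#[export] Hint Extern 1 (lin (@tw _ _ _)) => apply lin_tw : linear.
#[export] Hint Extern 1 (lin (@assocL _ _ _ _)) => apply lin_assocL : linear.
#[export] Hint Extern 1 (lin (@assocR _ _ _ _)) => apply lin_assocR : linear.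
#[export] Hint Resolve lin_tmap : linear.

(** * Multipliers *)

Section Multipliers.
Variables (k : fieldType) (V : lmodType k) (m : V -> V -> V).
Hypotheses (bm : bil m) (mA : associative m) (nm : Defs.nondegenerate m).

Lemma nondegenerate_cancell x y : (forall c, m c x = m c y) -> x = y.
Proof.
move=> xy; apply/eqP; rewrite -subr_eq0; apply/eqP; apply: nm.1 => c.
by rewrite -scaleN1r addrC (bm.1 c) xy scaleN1r addNr.
Qed.

Lemma nondegenerate_cancelr x y : (forall c, m x c = m y c) -> x = y.
Proof.
move=> xy; apply/eqP; rewrite -subr_eq0; apply/eqP; apply: nm.2 => c.
by rewrite -scaleN1r addrC (bm.2 c) xy scaleN1r addNr.
Qed.

(** A multiplier is given by the mixed identity alone; non-degeneracy turns its two components into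
    module maps. *)
Lemma mult_mull X x y : is_mult m X -> X.1 (m x y) = m (X.1 x) y.
Proof.
move=> [_ _ Xm]; apply: nondegenerate_cancell => z.
by rewrite Xm !mA Xm.
Qed.

Lemma mult_mulr X x y : is_mult m X -> X.2 (m x y) = m x (X.2 y).
Proof.
move=> [_ _ Xm]; apply: nondegenerate_cancelr => z.
by rewrite -Xm -!mA Xm.
Qed.

(** This is the associativity (Y z) X = Y (z X), [X.2] being right multiplication by [X]. *)
Lemma mult_sides_commute X Y z : is_mult m X -> is_mult m Y ->
  X.2 (Y.1 z) = Y.1 (X.2 z).
Proof.
move=> Xm Ym; apply: nondegenerate_cancell => u.
have [_ _ YM] := Ym.
by rewrite -(mult_mulr u _ Xm) !YM (mult_mulr _ _ Xm).
Qed.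

Lemma memb_is_mult a : is_mult m (memb m a).
Proof. by split; [exact: bm.1|exact: bm.2|move=> x y; exact: mA]. Qed.

Lemma memb_multl X a : is_mult m X -> memb m (X.1 a) = mmul X (memb m a).
Proof.
move=> Xm; have [_ _ XM] := Xm; rewrite /memb /mmul; congr pair; apply/funext => y /=.
  by rewrite mult_mull.
by rewrite XM.
Qed.

Lemma memb_multr X a : is_mult m X -> memb m (X.2 a) = mmul (memb m a) X.
Proof.
move=> Xm; have [_ _ XM] := Xm; rewrite /memb /mmul; congr pair; apply/funext => y /=.
  by rewrite XM.
by rewrite mult_mulr.
Qed.
End Multipliers.

(** * Tensor product of two non-unital algebras *)

Section TensorProductAlgebra.
Variables (k : fieldType) (U V : lmodType k).
Variables (m : U -> U -> U) (n : V -> V -> V).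

(** [mul2] and [mul3] are instances by conversion. A third instance is the product on the other
    bracketing, A (x) (A (x) A). *)
Definition tmul (x y : tensor U V) : tensor U V :=
  tlift (fun a b => tlift (fun c d => tens (m a c) (n b d)) y) x.

Lemma nu_algebra_bil : nu_algebra m -> bil m.
Proof. by case. Qed.

Hypotheses (bm : bil m) (bn : bil n).

Lemma bil_tmul : bil tmul.
Proof. by rewrite /tmul; linear_tac. Qed.

Lemma tmulE a b c d : tmul (tens a b) (tens c d) = tens (m a c) (n b d).
Proof. by rewrite /tmul !tliftE //; linear_tac. Qed.

Lemma tmul_tensl a b y : tmul (tens a b) y = tmap (m a) (n b) y.
Proof. by rewrite /tmul tliftE //; linear_tac. Qed.

Lemma tmul_tensr x c d : tmul x (tens c d) = tmap (fun a => m a c) (fun b => n b d) x.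
Proof.
rewrite /tmul; apply: eq_tlift => a b; rewrite tliftE //; linear_tac.
Qed.

Lemma tmulA : associative m -> associative n -> associative tmul.
Proof.
move=> mA nA x y z; have bt := bil_tmul.
apply: (tensor_ext (f := fun x => tmul x (tmul y z)) (g := fun x => tmul (tmul x y) z)).
- by linear_tac.
- by linear_tac.
move=> a b.
apply: (tensor_ext (f := fun y => tmul (tens a b) (tmul y z))
          (g := fun y => tmul (tmul (tens a b) y) z)).
- by linear_tac.
- by linear_tac.
move=> c d.
apply: (tensor_ext (f := fun z => tmul (tens a b) (tmul (tens c d) z))
          (g := fun z => tmul (tmul (tens a b) (tens c d)) z)).
- by linear_tac.
- by linear_tac.
by move=> e f; rewrite !tmulE mA nA.
Qed.

Lemma tmap_id_comp (W W' X X' Y Z : lmodType k) (f : W' -> X) (g : X' -> Y)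
   (f' : W -> W') (g' : Z -> X') t : lin f -> lin g ->
  tmap f g (tmap f' g' t) = tmap (f \o f') (g \o g') t.
Proof. by move=> fl gl; rewrite {1}/tmap tlift_tmap //; linear_tac. Qed.

(** Multiplication by [tens a b] is a composite of two maps acting on one leg each, and joint
    injectivity treats the legs separately. *)
Lemma tmul_nondegenerate : Defs.nondegenerate m -> Defs.nondegenerate n ->
  Defs.nondegenerate tmul.
Proof.
have [mr ml] := bm; have [nr nl] := bn.
move=> [ndm1 ndm2] [ndn1 ndn2]; split=> t tz.
  apply: (tmap_left_jointly_injective mr ndm1) => a.
  apply: (tmap_right_jointly_injective nr ndn1) => b.
  by rewrite tmap_id_comp //; have := tz (tens a b); rewrite tmul_tensl.
apply: (tmap_left_jointly_injective ml ndm2) => a.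
apply: (tmap_right_jointly_injective nl ndn2) => b.
by rewrite tmap_id_comp // -(tz (tens a b)) tmul_tensr.
Qed.

Lemma tmul_is_mult X Y : is_mult m X -> is_mult n Y ->
  is_mult tmul (tmap X.1 Y.1, tmap X.2 Y.2).
Proof.
move=> [X1 X2 XM] [Y1 Y2 YM]; have bt := bil_tmul; split=> /=; [linear_tac..|].
move=> s t; move: s; apply: (tensor_ext (f := fun s => tmul s (tmap X.1 Y.1 t))
  (g := fun s => tmul (tmap X.2 Y.2 s) t)); [linear_tac..|move=> a b].
move: t; apply: (tensor_ext (f := fun t => tmul (tens a b) (tmap X.1 Y.1 t))
  (g := fun t => tmul (tmap X.2 Y.2 (tens a b)) t)); [linear_tac..|move=> c d].
by rewrite !tmapE // !tmulE XM YM.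
Qed.

Lemma mone_is_mult : is_mult m (mone U).
Proof. by split. Qed.
End TensorProductAlgebra.

(** * Operators on three tensor factors *)

Section Commutation.
Variables (k : fieldType) (A : lmodType k).
Notation AA := (tensor A A).
Notation AAA := (tensor (tensor A A) A).
Implicit Types X Y : AA -> AA.

Definition leg12 X : AAA -> AAA := tmap X id.
Definition leg23 Y : AAA -> AAA := @assocR _ A A A \o tmap id Y \o @assocL _ A A A.

Definition legs_commute X Y := leg12 X \o leg23 Y = leg23 Y \o leg12 X.

Lemma lin_leg12 X : lin X -> lin (leg12 X).
Proof. by move=> Xl; rewrite /leg12; linear_tac. Qed.

Lemma lin_leg23 X : lin X -> lin (leg23 X).
Proof. by move=> Xl; rewrite /leg23 /comp; linear_tac. Qed.

Definition tril (W : lmodType k) (H : A -> A -> A -> W) :=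
  [/\ forall y z, lin (fun x => H x y z), forall x z, lin (fun y => H x y z)
    & forall x y, lin (fun z => H x y z)].

Lemma tensor3_ext (W : lmodType k) (f g : AAA -> W) : lin f -> lin g ->
  (forall a b c, f (tens (tens a b) c) = g (tens (tens a b) c)) -> f =1 g.
Proof.
move=> fl gl fg; apply: tensor_ext => // t c.
apply: (tensor_ext (f := fun t => f (tens t c)) (g := fun t => g (tens t c))) => //.
- by linear_tac.
- by linear_tac.
Qed.

Lemma leg23_tens Y a b c : lin Y ->
  leg23 Y (tens (tens a b) c) = tlift (fun y z => tens (tens a y) z) (Y (tens b c)).
Proof. by move=> Yl; rewrite /leg23 /= assocLE tmapE // assocRE. Qed.

Lemma leg12_leg23_tens X Y a b c : lin X -> lin Y ->
  leg12 X (leg23 Y (tens (tens a b) c)) =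
  tlift (fun y z => tlift (fun x y' => tens (tens x y') z) (X (tens a y))) (Y (tens b c)).
Proof.
move=> Xl Yl; rewrite leg23_tens // (lin_through _ _ (lin_leg12 Xl)).
apply: eq_tlift => y z; rewrite /leg12 tmapE //.
by apply: (lin_expand (f := fun t => tens t z)); linear_tac.
Qed.

Lemma leg23_leg12_tens X Y a b c : lin X -> lin Y ->
  leg23 Y (leg12 X (tens (tens a b) c)) =
  tlift (fun x y => tlift (fun y' z => tens (tens x y') z) (Y (tens y c))) (X (tens a b)).
Proof.
move=> Xl Yl; rewrite /leg12 tmapE //.
rewrite (lin_expand (f := fun t => leg23 Y (tens t c))); last first.
  by have := lin_leg23 Yl; linear_tac.
by apply: eq_tlift => x y; rewrite leg23_tens.
Qed.

(** Sweedler form of the commutation: it can be applied under any trilinear map, inside a larger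
    expression. *)
Lemma legs_commuteE X Y : lin X -> lin Y -> legs_commute X Y ->
  forall (W : lmodType k) (H : A -> A -> A -> W), tril H -> forall a b c,
  tlift (fun y z => tlift (fun x y' => H x y' z) (X (tens a y))) (Y (tens b c)) =
  tlift (fun x y => tlift (fun y' z => H x y' z) (Y (tens y c))) (X (tens a b)).
Proof.
move=> Xl Yl XY W H [H1 H2 H3] a b c.
pose h := tlift (fun t z => tlift (fun x y => H x y z) t).
have hl : lin h by rewrite /h; linear_tac.
have hE x y z : h (tens (tens x y) z) = H x y z.
  by rewrite /h !tliftE //; linear_tac.
have := congr1 (fun F => h (F (tens (tens a b) c))) XY.
rewrite /= leg12_leg23_tens // leg23_leg12_tens // !(lin_through _ _ hl).
move=> e; transitivity (tlift (fun u v =>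
  h (tlift (fun x y' => tens (tens x y') v) (X (tens a u)))) (Y (tens b c))).
  apply: eq_tlift => u v; rewrite (lin_through _ _ hl).
  by apply: eq_tlift => x y; rewrite hE.
rewrite e; apply: eq_tlift => u v; rewrite (lin_through _ _ hl).
by apply: eq_tlift => x y; rewrite hE.
Qed.

Lemma tril_tens : tril (fun x y z : A => tens (tens x y) z).
Proof. by split; linear_tac. Qed.

Lemma legs_commuteP X Y : lin X -> lin Y ->
  (forall (W : lmodType k) (H : A -> A -> A -> W), tril H -> forall a b c,
  tlift (fun y z => tlift (fun x y' => H x y' z) (X (tens a y))) (Y (tens b c)) =
  tlift (fun x y => tlift (fun y' z => H x y' z) (Y (tens y c))) (X (tens a b))) ->
  legs_commute X Y.
Proof.
move=> Xl Yl h; apply/funext; apply: tensor3_ext.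
- by have := lin_leg12 Xl; have := lin_leg23 Yl; rewrite /comp; linear_tac.
- by have := lin_leg12 Xl; have := lin_leg23 Yl; rewrite /comp; linear_tac.
move=> a b c; rewrite /= leg12_leg23_tens // leg23_leg12_tens //.
exact: (h _ _ tril_tens).
Qed.

Lemma leg12_comp X X' : lin X -> leg12 X \o leg12 X' = leg12 (X \o X').
Proof. by move=> Xl; apply/funext => t; rewrite /leg12 /= tmap_id_comp. Qed.

Lemma assocLK : cancel (@assocL k A A A) (@assocR k A A A).
Proof.
apply: (tensor3_ext (f := fun t => assocR (assocL t)) (g := id)).
- by linear_tac.
- by linear_tac.
by move=> a b c; rewrite assocLE assocR_tens.
Qed.

Lemma assocRK : cancel (@assocR k A A A) (@assocL k A A A).
Proof.
apply: (tensor_ext (f := fun t => assocL (assocR t)) (g := id)).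
- by linear_tac.
- by linear_tac.
move=> a t; apply: (tensor_ext (f := fun t => assocL (assocR (tens a t))) (g := tens a)).
- by linear_tac.
- by linear_tac.
by move=> b c; rewrite assocR_tens assocLE.
Qed.

Lemma leg23_comp Y Y' : lin Y -> leg23 Y \o leg23 Y' = leg23 (Y \o Y').
Proof.
by move=> Yl; apply/funext => t; rewrite /leg23 /= assocRK tmap_id_comp.
Qed.
End Commutation.

(** * Weak multiplier bialgebras, up to the left-right symmetry *)

Section Counit.
Variables (k : fieldType) (A : lmodType k) (eps : A -> k^o).
Hypothesis epsL : lin eps.

Lemma lin_epsl : lin (epsl eps).
Proof. by rewrite /epsl; linear_tac. Qed.

Lemma lin_epsr : lin (epsr eps).
Proof. by rewrite /epsr; linear_tac. Qed.

Lemma epsrE a b : epsr eps (tens a b) = eps b *: a.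
Proof. by rewrite /epsr tliftE //; linear_tac. Qed.

Lemma epsl_tw t : epsl eps (tw t) = epsr eps t.
Proof. by rewrite /epsl tlift_tw //; linear_tac. Qed.

Lemma epsr_tw t : epsr eps (tw t) = epsl eps t.
Proof. by rewrite /epsr tlift_tw //; linear_tac. Qed.

Lemma eps_epsl_epsr t : eps (epsr eps t) = eps (epsl eps t).
Proof.
rewrite /epsr /epsl !(lin_through _ _ epsL); apply: eq_tlift => x y.
by rewrite !(linZ epsL); exact: mulrC.
Qed.
End Counit.
#[export] Hint Resolve lin_epsl lin_epsr : linear.

Lemma bil_mul2 (k : fieldType) (A : lmodType k) (mul : A -> A -> A) :
  bil mul -> bil (mul2 mul).
Proof. by move=> b; apply: (@bil_tmul k A A mul mul). Qed.
#[export] Hint Resolve bil_mul2 : linear.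

Lemma mul2E (k : fieldType) (A : lmodType k) (mul : A -> A -> A) a b c d :
  bil mul -> mul2 mul (tens a b) (tens c d) = tens (mul a c) (mul b d).
Proof. by move=> bm; apply: tmulE. Qed.

Lemma mul2_tensl (k : fieldType) (A : lmodType k) (mul : A -> A -> A) a b t :
  bil mul -> mul2 mul (tens a b) t = tmap (mul a) (mul b) t.
Proof. by move=> bm; apply: tmul_tensl. Qed.

Lemma mul2_tensr (k : fieldType) (A : lmodType k) (mul : A -> A -> A) a b t :
  bil mul -> mul2 mul t (tens a b) = tmap (mul^~ a) (mul^~ b) t.
Proof. by move=> bm; apply: tmul_tensr. Qed.

(* Every identity below is either self-dual or listed together with its mirror
   image, so that the record is stable under the symmetry of [core_flip].
   D1 a and D2 a stand for left and right multiplication by Delta(a). *)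
Record core (k : fieldType) (A : lmodType k) (mul : A -> A -> A) (eps : A -> k^o)
  (E1 E2 T1 T2 T3 T4 : tensor A A -> tensor A A)
  (D1 D2 : A -> tensor A A -> tensor A A) : Prop := Core {
  coreM : nu_algebra mul;
  coreI : idempotent_alg mul;
  coreN : Defs.nondegenerate mul;
  coreEps : lin eps;
  coreE : lin E1 /\ lin E2;
  coreT : lin T1 /\ lin T2;
  coreT' : lin T3 /\ lin T4;
  coreD : (forall a, lin (D1 a)) /\ (forall a, lin (D2 a));
  coreT2T1 : legs_commute T2 T1;
  coreE2T1 : legs_commute E2 T1;
  coreT2E1 : legs_commute T2 E1;
  coreE2E1 : legs_commute E2 E1;
  core_counit1 : forall t, epsl eps (T1 t) = tmu mul t;
  core_counit2 : forall t, epsr eps (T2 t) = tmu mul t;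
  core_mixed : forall a p t, tmap (mul a) id (T1 (tens p t)) =
                             tmap id (mul^~ t) (T2 (tens a p));
  coreE1T1 : forall t, E1 (T1 t) = T1 t;
  coreE2T2 : forall t, E2 (T2 t) = T2 t;
  coreT4M : forall y b d,
    tlift (fun s t => mul (epsr eps (T1 (tens y t))) s) (T4 (tens d b)) =
    mul (mul y b) d;
  coreT3M : forall y b d,
    tlift (fun s t => mul t (epsl eps (T2 (tens s y)))) (T3 (tens b d)) =
    mul d (mul b y);
  coreE2T4 : forall w d b,
    mul2 mul (E2 w) (T4 (tens d b)) = mul2 mul w (T4 (tens d b));
  coreT3E1 : forall w b d,
    mul2 mul (T3 (tens b d)) (E1 w) = mul2 mul (T3 (tens b d)) w;
  coreT1D : forall a t, T1 (tmap (mul a) id t) = D1 a (T1 t);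
  coreT2D : forall a t, T2 (tmap id (mul^~ a) t) = D2 a (T2 t);
  coreD1E : forall a t, D1 a (E1 t) = D1 a t;
  coreD2E : forall a t, D2 a (E2 t) = D2 a t;
  coreD2T4 : forall b d w, tmap (mul^~ d) id (D2 b w) = mul2 mul w (T4 (tens d b));
  coreD1T3 : forall b d w, tmap id (mul d) (D1 b w) = mul2 mul (T3 (tens b d)) w;
  coreT1r : forall p q d, T1 (tens p (mul q d)) = tmap id (mul^~ d) (T1 (tens p q));
  coreT2l : forall p q d, T2 (tens (mul d q) p) = tmap (mul d) id (T2 (tens q p));
  coreE1span : forall M, subspace M -> (forall a b c, M (D1 a (tens b c))) ->
    forall w, M (E1 w);
  coreE2span : forall M, subspace M -> (forall a b c, M (D2 a (tens b c))) ->
    forall w, M (E2 w) }.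

(* The opposite multiplication together with the coopposite comultiplication:
   this symmetry exchanges T_1 and T_2, T_3 and T_4, and the two sides of E. *)
Section Flip.
Variables (k : fieldType) (A : lmodType k).
Implicit Types X Y : tensor A A -> tensor A A.

Definition flip X : tensor A A -> tensor A A := fun t => tw (X (tw t)).

Lemma lin_flip X : lin X -> lin (flip X).
Proof. by move=> Xl; rewrite /flip; linear_tac. Qed.

Lemma flipK X : flip (flip X) = X.
Proof. by apply/funext => t; rewrite /flip !twK. Qed.

Lemma flip_tens X a b : flip X (tens a b) = tw (X (tens b a)).
Proof. by rewrite /flip twE. Qed.

Lemma tmap_tw (f g : A -> A) (t : tensor A A) : lin f -> lin g ->
  tmap f g (tw t) = tw (tmap g f t).
Proof.
move=> fl gl; apply: (tensor_ext (f := fun t => tmap f g (tw t))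
                                 (g := fun t => tw (tmap g f t))).
- by linear_tac.
- by linear_tac.
by move=> u v; rewrite twE !tmapE // twE.
Qed.

Lemma mul2_tw (mul : A -> A -> A) (x y : tensor A A) : bil mul ->
  mul2 (fun a b => mul b a) (tw x) (tw y) = tw (mul2 mul y x).
Proof.
move=> bm; have [mr ml] := bm.
have bm' : bil (fun a b => mul b a) by split; linear_tac.
apply: (tensor_ext (f := fun x => mul2 (fun a b => mul b a) (tw x) (tw y))
                   (g := fun x => tw (mul2 mul y x))).
- by linear_tac.
- by linear_tac.
move=> a b; apply: (tensor_ext
   (f := fun y => mul2 (fun a b => mul b a) (tw (tens a b)) (tw y))
   (g := fun y => tw (mul2 mul y (tens a b)))).
- by linear_tac.
- by linear_tac.
by move=> c d; rewrite !twE !mul2E // twE.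
Qed.

(** Reversing the three factors turns [X] on legs 1, 2 into [flip X] on legs 2, 3, so the two
    operators trade places. *)
Lemma legs_commute_flip X Y : lin X -> lin Y ->
  legs_commute X Y -> legs_commute (flip Y) (flip X).
Proof.
move=> Xl Yl XY; apply: legs_commuteP; [exact: lin_flip|exact: lin_flip|].
move=> W H [H1 H2 H3] a b c.
rewrite flip_tens tlift_tw; last by have := lin_flip Yl; linear_tac.
rewrite flip_tens tlift_tw; last by have := lin_flip Xl; linear_tac.
transitivity (tlift (fun z y => tlift (fun y' x => H x y' z) (Y (tens y a))) (X (tens c b))).
  by apply: eq_tlift => v u; rewrite flip_tens tlift_tw //; linear_tac.
rewrite -(legs_commuteE Xl Yl XY (H := fun z y x => H x y z)); last by split; linear_tac.
by apply: eq_tlift => v u; rewrite flip_tens tlift_tw //; linear_tac.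
Qed.

Lemma core_flip mul eps E1 E2 T1 T2 T3 T4 (D1 D2 : A -> tensor A A -> tensor A A) :
  core mul eps E1 E2 T1 T2 T3 T4 D1 D2 ->
  core (fun a b => mul b a) eps (flip E2) (flip E1) (flip T2) (flip T1)
    (flip T4) (flip T3) (fun a => flip (D2 a)) (fun a => flip (D1 a)).
Proof.
case=> bM idem nd el [E1l E2l] [T1l T2l] [T3l T4l] [D1l D2l] c1 c2 c3 c4 cu1 cu2
  mix ET1 ET2 T4M T3M ET4 TE3 T1D T2D D1E D2E D2T4 D1T3 T1r T2l' sp1 sp2.
have [mr ml mA] := bM; have bm := nu_algebra_bil bM.
have lf := lin_flip; have cf := legs_commute_flip.
have tmu_tw t : tmu mul (tw t) = tmu (fun a b => mul b a) t by rewrite /tmu tlift_tw.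
(* The spanning principles for E transfer because the preimage of a subspace under the twist is a
   subspace. *)
have subtw M : subspace M -> subspace (fun t : tensor A A => M (tw t)).
  move=> [M0 Mlin]; split; first by rewrite (lin0 (@lin_tw _ _ _)).
  by move=> c x y Mx My; rewrite (@lin_tw k A A); apply: Mlin.
split.
- by split=> // a b c; rewrite mA.
- by move=> x; have [t tx] := idem x; exists (tw t); rewrite -tmu_tw twK.
- by case: nd.
- by [].
- by split; apply: lf.
- by split; apply: lf.
- by split; apply: lf.
- by split=> a; apply: lf.
- exact: cf.
- exact: cf.
- exact: cf.
- exact: cf.
- by move=> t; rewrite epsl_tw // cu2 tmu_tw.
- by move=> t; rewrite epsr_tw // cu1 tmu_tw.
- by move=> a p t; rewrite !flip_tens !tmap_tw // mix.
- by move=> t; rewrite /flip twK ET2.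
- by move=> t; rewrite /flip twK ET1.
- move=> y b d; rewrite flip_tens tlift_tw; last by have := lf _ T2l; linear_tac.
  by rewrite -T3M; apply: eq_tlift => s t; rewrite flip_tens epsr_tw.
- move=> y b d; rewrite flip_tens tlift_tw; last by have := lf _ T1l; linear_tac.
  by rewrite -T4M; apply: eq_tlift => s t; rewrite flip_tens epsl_tw.
- by move=> w d b; rewrite -{2}[w]twK !flip_tens !mul2_tw // TE3.
- by move=> w b d; rewrite -{2}[w]twK !flip_tens !mul2_tw // ET4.
- by move=> a t; rewrite /flip twK -T2D -{1}[t]twK tmap_tw // twK.
- by move=> a t; rewrite /flip twK -T1D -{1}[t]twK tmap_tw // twK.
- by move=> a t; rewrite /flip twK D2E.
- by move=> a t; rewrite /flip twK D1E.
- by move=> b d w; rewrite -{2}[w]twK flip_tens mul2_tw // tmap_tw // D1T3.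
- by move=> b d w; rewrite -{2}[w]twK flip_tens mul2_tw // tmap_tw // D2T4.
- by move=> p q d; rewrite !flip_tens T2l' tmap_tw.
- by move=> p q d; rewrite !flip_tens T1r tmap_tw.
- move=> M subM MD w; apply: (sp2 (fun t => M (tw t))); first exact: subtw.
  by move=> a b c; rewrite -flip_tens.
- move=> M subM MD w; apply: (sp1 (fun t => M (tw t))); first exact: subtw.
  by move=> a b c; rewrite -flip_tens.
Qed.
End Flip.

(** * Statements about T_1, G_1 and R_1; the mirror images follow by [core_flip] *)

Section OneSide.
Variables (k : fieldType) (A : lmodType k) (mul : A -> A -> A) (eps : A -> k^o)
  (E1 E2 T1 T2 T3 T4 : tensor A A -> tensor A A)
  (D1 D2 : A -> tensor A A -> tensor A A).
Hypothesis C : core mul eps E1 E2 T1 T2 T3 T4 D1 D2.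
Notation AA := (tensor A A).

Let bm : bil mul. Proof. exact: nu_algebra_bil (coreM C). Qed.
Let mr : forall a, lin (mul a). Proof. by case: bm. Qed.
Let ml : forall a, lin (fun x => mul x a). Proof. by case: bm. Qed.
Let mA : associative mul. Proof. by case: (coreM C). Qed.
Let el : lin eps. Proof. exact: coreEps C. Qed.
Let E1l : lin E1. Proof. by case: (coreE C). Qed.
Let E2l : lin E2. Proof. by case: (coreE C). Qed.
Let T1l : lin T1. Proof. by case: (coreT C). Qed.
Let T2l : lin T2. Proof. by case: (coreT C). Qed.
Let T4l : lin T4. Proof. by case: (coreT' C). Qed.
Let D1l : forall a, lin (D1 a). Proof. by case: (coreD C). Qed.
Let D2l : forall a, lin (D2 a). Proof. by case: (coreD C). Qed.

(** Products span the idempotent algebra A. This is what gives access to G_1, which is described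
    only when its second argument is a product. *)
Lemma product_ext (W : lmodType k) (f g : A -> W) : lin f -> lin g ->
  (forall b d, f (mul b d) = g (mul b d)) -> f =1 g.
Proof.
move=> fl gl fg x; have [t <-] := coreI C x.
rewrite /tmu (lin_through _ _ fl) (lin_through _ _ gl).
exact: eq_tlift.
Qed.

Lemma tmap_mul_cancel (s t : AA) :
  (forall c, tmap (mul c) id s = tmap (mul c) id t) -> s = t.
Proof.
move=> st; apply/eqP; rewrite -subr_eq0; apply/eqP.
apply: (tmap_left_jointly_injective mr (coreN C).1) => c.
have l : lin (tmap (mul c) (@id A)) by linear_tac.
by rewrite -scaleN1r addrC l st scaleN1r addNr.
Qed.

(* a (PiR t) = (id (x) eps)(Delta(a) (1 (x) t)) has been unfolded, and the twist
   of T_4 is absorbed in the exchanged roles of s and t. *)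
Definition G1_spec (G : AA -> AA) := lin G /\ forall a b d,
  G (tens a (mul b d)) =
  tlift (fun s t => tens (epsr eps (T1 (tens a t))) s) (T4 (tens d b)).

Lemma eps_epsr_T1 x t : eps (epsr eps (T1 (tens x t))) = eps (mul x t).
Proof.
by rewrite eps_epsl_epsr // (core_counit1 C) /tmu tliftE.
Qed.

(** As [epsr eps (T1 (tens a t))] is a PiR(t), the claim is that X commutes with right
    multiplication of its second leg by PiR(t). It is the commutation of X with T_1 after applying
    the counit to the third leg. *)
Lemma counit_through X (W : lmodType k) (K : A -> A -> W) c a t :
  lin X -> legs_commute X T1 -> bil K ->
  tlift K (X (tens c (epsr eps (T1 (tens a t))))) =
  tlift (fun x y => K x (epsr eps (T1 (tens y t)))) (X (tens c a)).
Proof.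
move=> Xl XT bK; have [Kr Kl] := bK.
transitivity (tlift (fun y z => tlift (fun x y' => (eps z : k) *: K x y')
                                  (X (tens c y))) (T1 (tens a t))).
  rewrite [in LHS]/epsr (lin_through _ _ (g := fun u => tlift K (X (tens c u)))).
    apply: eq_tlift => y z.
    rewrite (linZ (f := fun u => tlift K (X (tens c u)))); last by linear_tac.
    by rewrite (lin_through _ _ (g := fun u : W => (eps z : k) *: u)) //; linear_tac.
  by linear_tac.
rewrite (legs_commuteE Xl T1l XT (H := fun x y z => (eps z : k) *: K x y)).
  apply: eq_tlift => x y; rewrite /epsr (lin_through _ _ (Kr x)).
  by apply: eq_tlift => y' z; rewrite (linZ (Kr _)).
by split; linear_tac.
Qed.

Section G1.
Variable G : AA -> AA.
Hypothesis GS : G1_spec G.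
Let Gl : lin G. Proof. by case: GS. Qed.

Lemma G1_through (W : lmodType k) (K : A -> A -> W) a b d : bil K ->
  tlift K (G (tens a (mul b d))) =
  tlift (fun s t => K (epsr eps (T1 (tens a t))) s) (T4 (tens d b)).
Proof.
move=> bK; rewrite GS.2 (lin_through _ _ (lin_tlift bK)).
by apply: eq_tlift => s t; rewrite tliftE.
Qed.

(** Test by c on the first leg. The mixed identity (c (x) 1)T_1(p (x) s) = T_2(c (x) p)(1 (x) s)
    replaces T_1 by T_2, [counit_through] carries PiR(t) past T_2, and [coreT4M] collapses the sum
    over T_4. *)
Lemma T1_G1 t : T1 (G t) = T1 t.
Proof.
move: t; apply: (tensor_ext (f := fun t => T1 (G t))); rewrite //.
  by linear_tac.
move=> a; apply: (product_ext (f := fun u => T1 (G (tens a u)))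
                              (g := fun u => T1 (tens a u))).
- by linear_tac.
- by linear_tac.
move=> b d; apply: tmap_mul_cancel => c.
transitivity (tlift (fun s t => tlift (fun x y =>
  tens x (mul (epsr eps (T1 (tens y t))) s)) (T2 (tens c a))) (T4 (tens d b))).
  rewrite GS.2 (lin_through _ _ (g := fun u => tmap (mul c) id (T1 u))); last first.
    by linear_tac.
  apply: eq_tlift => s t; rewrite (core_mixed C).
  apply: (counit_through (K := fun x y => tens x (mul y s))) => //.
    exact: coreT2T1 C.
  by linear_tac.
rewrite tlift_exchange (core_mixed C) /tmap; apply: eq_tlift => x y.
rewrite -(lin_through _ _ (g := tens x)); last by linear_tac.
by rewrite (coreT4M C) mA.
Qed.

(** G_1 multiplies the second leg by some PiR(t) and inserts elements independent of that leg, so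
    [counit_through] suffices. *)
Lemma commute_G1 X : lin X -> legs_commute X T1 -> legs_commute X G.
Proof.
move=> Xl XT; apply: legs_commuteP => // W H [H1 H2 H3] a b.
apply: product_ext; [linear_tac..|move=> e d].
transitivity (tlift (fun s t => tlift (fun x y => H x (epsr eps (T1 (tens y t))) s)
                                  (X (tens a b))) (T4 (tens d e))).
  rewrite G1_through; last by linear_tac.
  apply: eq_tlift => s t; apply: (counit_through (K := fun x y => H x y s)) => //.
rewrite tlift_exchange; apply: eq_tlift => x y.
by rewrite G1_through //; linear_tac.
Qed.

Lemma epsr_mul2 (w t : AA) : epsr eps (mul2 mul w t) =
  tlift (fun u v => tlift (fun x y => (eps (mul v y) : k) *: mul u x) t) w.
Proof.
have el' := lin_epsr el; rewrite /mul2 (lin_through _ _ el').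
apply: eq_tlift => u v; rewrite (lin_through _ _ el').
by apply: eq_tlift => x y; rewrite epsrE.
Qed.

(** On w = x (x) b d the left side is (id (x) eps)((c (x) x) T_4(d (x) b)). Since E Delta(b) =
    Delta(b), an E may be inserted between the two factors, and [counit_through] for right
    multiplication by E gives the right side. *)
Lemma counit_G1 c w : mul c (epsl eps (G w)) =
  tlift (fun x y => mul (epsr eps (E2 (tens c x))) y) (G w).
Proof.
move: w; apply: tensor_ext; [linear_tac..|move=> x].
apply: (product_ext
  (f := fun u => mul c (epsl eps (G (tens x u))))
  (g := fun u => tlift (fun x y => mul (epsr eps (E2 (tens c x))) y) (G (tens x u)))).
- by linear_tac.
- by linear_tac.
move=> b d; transitivity (epsr eps (mul2 mul (tens c x) (T4 (tens d b)))).
  rewrite /epsl G1_through; last by linear_tac.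
  rewrite epsr_mul2 tliftE; last by linear_tac.
  rewrite (lin_through _ _ (mr c)); apply: eq_tlift => s t.
  by rewrite (linZ (mr c)) eps_epsr_T1.
rewrite -(coreE2T4 C) epsr_mul2 tlift_exchange G1_through; last by linear_tac.
apply: eq_tlift => s t; rewrite [X in mul X s]/epsr.
rewrite (counit_through (K := fun u v => (eps v : k) *: u)) //.
- rewrite (lin_through _ _ (ml s)); apply: eq_tlift => u v.
  by rewrite (linZ (ml s)) eps_epsr_T1.
- exact: coreE2T1 C.
- by linear_tac.
Qed.
End G1.

(** * From an antipode to R_1 *)

Section FromS.
Variables S1 S2 : A -> A -> A.
Hypotheses (S1l : forall y, lin (fun x => S1 x y)) (S1r : forall x, lin (S1 x))
  (S2l : forall y, lin (fun x => S2 x y)) (S2r : forall x, lin (S2 x)).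
Hypothesis Smult : forall a b c, mul b (S1 a c) = mul (S2 a b) c.
Hypothesis axvii : forall a b c,
  T1 (tlift (fun x y => tens x (S1 y c)) (T2 (tens a b))) = D1 a (tens b c).
Hypothesis axviii : forall a b c,
  T2 (tlift (fun x y => tens (S2 x a) y) (T1 (tens b c))) = D2 c (tens a b).

(** Apply id (x) eps to (viii) and use (id (x) eps) T_2 = mu. *)
Lemma antipode_convolution c p q :
  tlift (fun x y => mul (S2 x c) y) (T1 (tens p q)) = epsr eps (D2 q (tens c p)).
Proof.
rewrite -axviii (core_counit2 C) /tmu (lin_through _ _ (lin_tlift bm)).
by apply: eq_tlift => x y; rewrite tliftE.
Qed.

(* S(p_1) p_2 (b d) = eps(p b_2) b_1 d: the factor d is there so that
   Delta(b)(d (x) 1) lies in A (x) A. *)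
Lemma antipode_convolution_mul p b d :
  tlift S1 (T1 (tens p (mul b d))) =
  tlift (fun s t => (eps (mul p t) : k) *: s) (T4 (tens d b)).
Proof.
apply: (nondegenerate_cancell bm (coreN C)) => c.
transitivity (mul (epsr eps (D2 b (tens c p))) d).
  rewrite -antipode_convolution (coreT1r C) tlift_tmap; last by linear_tac.
  rewrite (lin_through _ _ (mr c)) (lin_through _ _ (ml d)).
  by apply: eq_tlift => x y; rewrite Smult mA.
transitivity (epsr eps (tmap (mul^~ d) id (D2 b (tens c p)))).
  rewrite {2}/epsr tlift_tmap; last by linear_tac.
  rewrite /epsr (lin_through _ _ (ml d)); apply: eq_tlift => x y.
  by rewrite (linZ (ml d)).
rewrite (coreD2T4 C) epsr_mul2 tliftE; last by linear_tac.
rewrite (lin_through _ _ (mr c)); apply: eq_tlift => x y.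
by rewrite (linZ (mr c)).
Qed.

(** This is w |-> (a (x) 1) R_1(w), written in terms of S before R_1 is available; compare
    [mul_R1]. *)
Definition antipode_T2 a (w : AA) :=
  tlift (fun b c => tlift (fun x y => tens x (S1 y c)) (T2 (tens a b))) w.

(** Commuting T_2 with T_1 brings S next to T_1, where [antipode_convolution_mul] removes it;
    [core_mixed] reassembles what remains. As a is arbitrary, non-degeneracy shows that G z depends
    only on T_1 z. *)
Lemma antipode_T2_T1 G : G1_spec G -> forall a z,
  antipode_T2 a (T1 z) = tmap (mul a) id (G z).
Proof.
move=> GS a; have Gl := GS.1; rewrite /antipode_T2.
apply: tensor_ext; [linear_tac..|move=> p].
apply: (product_ext (f := fun q => tlift (fun b c =>
          tlift (fun x y => tens x (S1 y c)) (T2 (tens a b))) (T1 (tens p q)))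
        (g := fun q => tmap (mul a) id (G (tens p q)))).
- by linear_tac.
- by linear_tac.
move=> b d.
rewrite (legs_commuteE T2l T1l (coreT2T1 C) (H := fun x y z => tens x (S1 y z))); last first.
  by split; linear_tac.
rewrite /tmap (G1_through GS); last by linear_tac.
transitivity (tlift (fun x y => tlift (fun s t => (eps (mul y t) : k) *: tens x s)
                (T4 (tens d b))) (T2 (tens a p))).
  apply: eq_tlift => x y; rewrite -(lin_through _ _ (g := tens x)); last by linear_tac.
  rewrite antipode_convolution_mul (lin_through _ _ (g := tens x)); last by linear_tac.
  by apply: eq_tlift => s t; rewrite (linZ ((bil_tens _ _).1 x)).
rewrite tlift_exchange; apply: eq_tlift => s t.
transitivity (tens (epsr eps (tmap id (mul^~ t) (T2 (tens a p)))) s).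
  rewrite /epsr tlift_tmap; last by linear_tac.
  rewrite (lin_through _ _ (g := fun u => tens u s)); last by linear_tac.
  by apply: eq_tlift => x y; rewrite (linZ ((bil_tens _ _).2 s)).
rewrite -(core_mixed C) /epsr tlift_tmap; last by linear_tac.
congr tens; rewrite (lin_through _ _ (mr a)).
by apply: eq_tlift => x y; rewrite (linZ (mr a)).
Qed.

Lemma E1_image w : exists z, T1 z = E1 w.
Proof.
apply: (coreE1span C (M := fun u => exists z, T1 z = u)).
  split; first by exists 0; exact: lin0.
  by move=> c x y [u <-] [v <-]; exists (c *: u + v); rewrite T1l.
by move=> a b c; rewrite -axvii; eexists.
Qed.

Lemma R1_exists G : G1_spec G -> exists R, [/\ lin R,
  forall t, R (T1 t) = G t, forall t, T1 (R t) = E1 t & forall t, R (T1 (R t)) = R t].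
Proof.
move=> GS; have Gl := GS.1.
have GT u v : T1 u = T1 v -> G u = G v.
  by move=> e; apply: tmap_mul_cancel => c; rewrite -!antipode_T2_T1 // e.
pose z w := projT1 (cid (E1_image w)).
have zE w : T1 (z w) = E1 w by exact: (projT2 (cid (E1_image w))).
have RT t : G (z (T1 t)) = G t by apply: GT; rewrite zE (coreE1T1 C).
exists (fun w => G (z w)); split=> [c x y|t|t|t] //.
(* The section [z] is chosen pointwise and need not be linear; [GT] absorbs the discrepancy. *)
- by rewrite -Gl; apply: GT; rewrite zE T1l !zE E1l.
- by rewrite (T1_G1 GS) zE.
- by rewrite RT; apply: GT; rewrite (T1_G1 GS).
Qed.

Lemma antipode_left_action (axix : forall a d, tlift S1 (E1 (tens a d)) = S1 a d) c a d z :
  T1 z = E1 (tens a d) ->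
  mul c (S1 a d) = tlift (fun p q => epsr eps (D2 q (tens c p))) z.
Proof.
move=> Tz; rewrite -axix -Tz.
rewrite (lin_expand (f := fun z => mul c (tlift S1 (T1 z)))); last by linear_tac.
apply: eq_tlift => p q; rewrite -antipode_convolution (lin_through _ _ (mr c)).
by apply: eq_tlift => x y; rewrite Smult.
Qed.
End FromS.

(** * From R_1 to the antipode axioms *)

Section FromR.
Variables (G R : AA -> AA).
Hypotheses (GS : G1_spec G) (Rl : lin R) (RT : forall t, R (T1 t) = G t)
  (TR : forall t, T1 (R t) = E1 t) (RTR : forall t, R (T1 (R t)) = R t).

(** Commute T_2 with R and apply the counit to the middle leg, where (id (x) eps) T_2 = mu turns
    T_2(a (x) y) into a y. *)
Lemma mul_R1 a b c : legs_commute T2 R -> tmap (mul a) id (R (tens b c)) =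
  tlift (fun x y => tens x (epsl eps (R (tens y c)))) (T2 (tens a b)).
Proof.
move=> T2R.
transitivity (tlift (fun x y => tlift (fun y' z => tens x ((eps y' : k) *: z))
    (R (tens y c))) (T2 (tens a b))).
  rewrite -(legs_commuteE T2l Rl T2R (H := fun x y z => tens x ((eps y : k) *: z))).
    rewrite /tmap; apply: eq_tlift => y z.
    have -> : mul a y = epsr eps (T2 (tens a y)).
      by rewrite (core_counit2 C) /tmu tliftE.
    rewrite /epsr (lin_through _ _ ((bil_tens _ _).2 (id z))).
    apply: eq_tlift => x y'.
    by rewrite (linZ ((bil_tens _ _).2 _)) (linZ ((bil_tens _ _).1 _)).
  by split; linear_tac.
apply: eq_tlift => x y; rewrite /epsl (lin_through _ _ (g := tens x)) //; linear_tac.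
Qed.

Lemma R1_axvii a b c : legs_commute T2 R ->
  T1 (tlift (fun x y => tens x (epsl eps (R (tens y c)))) (T2 (tens a b))) =
  D1 a (tens b c).
Proof. by move=> T2R; rewrite -mul_R1 // (coreT1D C) TR (coreD1E C). Qed.

(** R T_1 R = R and T_1 R = E_1 give R E_1 = R; apply eps (x) id. *)
Lemma R1_axix a d :
  tlift (fun x y => epsl eps (R (tens x y))) (E1 (tens a d)) = epsl eps (R (tens a d)).
Proof.
rewrite -[RHS](congr1 (epsl eps) (RTR _)) TR.
by rewrite [RHS](lin_expand (f := fun t => epsl eps (R t))) //; linear_tac.
Qed.

Lemma counit_R1 a b c : mul c (epsl eps (R (tens a b))) =
  tlift (fun x y => mul (epsr eps (E2 (tens c x))) y) (R (tens a b)).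
Proof. by rewrite -RTR RT; exact: counit_G1. Qed.
End FromR.
End OneSide.

(** * The correspondence *)

(** R U = R T R U = R U T R = R T U R = U R T R = U R. *)
Lemma generalized_inverse_commute (Z : Type) (R T U : Z -> Z) :
  R \o T \o R = R -> T \o U = U \o T -> (T \o R) \o U = U \o (T \o R) ->
  (R \o T) \o U = U \o (R \o T) -> R \o U = U \o R.
Proof.
move=> /funeqP RTR /funeqP TU /funeqP TRU /funeqP RTU; apply/funext => z.
transitivity (R (T (R (U z)))); first by rewrite -[LHS]RTR.
rewrite [T _](TRU z) /= -[U _]TU [LHS](RTU (R z)) /=; congr U; exact: RTR.
Qed.

Section GeneralizedInverseLegs.
Variables (k : fieldType) (A : lmodType k).
Implicit Types R T X : tensor A A -> tensor A A.

Lemma legs_commute_inverse_l R T X : lin R -> lin T -> R \o T \o R = R ->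
  legs_commute T X -> legs_commute (T \o R) X -> legs_commute (R \o T) X ->
  legs_commute R X.
Proof.
move=> Rl Tl RTR; rewrite /legs_commute => TX TRX RTX.
apply: (generalized_inverse_commute (T := leg12 T)) => //.
- by rewrite !leg12_comp // ?RTR // /comp; linear_tac.
- by rewrite leg12_comp.
- by rewrite leg12_comp.
Qed.

Lemma legs_commute_inverse_r R T X : lin R -> lin T -> R \o T \o R = R ->
  legs_commute X T -> legs_commute X (T \o R) -> legs_commute X (R \o T) ->
  legs_commute X R.
Proof.
move=> Rl Tl RTR; rewrite /legs_commute => TX TRX RTX.
apply/esym; apply: (generalized_inverse_commute (T := leg23 T)) => //.
- by rewrite !leg23_comp // ?RTR // /comp; linear_tac.
- by rewrite leg23_comp.
- by rewrite leg23_comp.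
Qed.
End GeneralizedInverseLegs.

(** * Both sides together: existence and uniqueness of each kind of data *)

Section TwoSides.
Variables (k : fieldType) (A : lmodType k) (mul : A -> A -> A) (eps : A -> k^o)
  (E : mult (tensor A A)) (T1 T2 T3 T4 G1 G2 : tensor A A -> tensor A A)
  (Delta : A -> mult (tensor A A)).
Hypothesis C : core mul eps E.1 E.2 T1 T2 T3 T4
  (fun a => (Delta a).1) (fun a => (Delta a).2).
Hypothesis GS1 : G1_spec mul eps T1 T4 G1.
Hypothesis GS2 : G1_spec (fun a b => mul b a) eps (flip T2) (flip T3) (flip G2).

Let C' := core_flip C.
Let bm : bil mul. Proof. exact: nu_algebra_bil (coreM C). Qed.
Let mr : forall a, lin (mul a). Proof. by case: bm. Qed.
Let ml : forall a, lin (fun x => mul x a). Proof. by case: bm. Qed.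
Let mA : associative mul. Proof. by case: (coreM C). Qed.
Let el : lin eps. Proof. exact: coreEps C. Qed.
Let E1l : lin E.1. Proof. by case: (coreE C). Qed.
Let E2l : lin E.2. Proof. by case: (coreE C). Qed.
Let T1l : lin T1. Proof. by case: (coreT C). Qed.
Let T2l : lin T2. Proof. by case: (coreT C). Qed.
Let G2l : lin G2. Proof. by rewrite -[G2]flipK; apply: lin_flip; case: GS2. Qed.

Lemma legs_commute_G2 X : lin X -> legs_commute T2 X -> legs_commute G2 X.
Proof.
move=> Xl TX; rewrite -[G2]flipK -[X]flipK; apply: legs_commute_flip.
- exact: lin_flip.
- exact: lin_flip.
apply: (commute_G1 C' GS2); first exact: lin_flip.
exact: legs_commute_flip.
Qed.

Section FromData.
Variables R1 R2 : tensor A A -> tensor A A.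
Hypothesis dataR : data_R E T1 T2 G1 G2 (R1, R2).

Let R1l : lin R1. Proof. by case: dataR. Qed.
Let R2l : lin R2. Proof. by case: dataR. Qed.
Let RT1 : R1 \o T1 = G1. Proof. by case: dataR => _ _ []. Qed.
Let TR1 : T1 \o R1 = E.1. Proof. by case: dataR => _ _ []. Qed.
Let RTR1 : R1 \o T1 \o R1 = R1. Proof. by case: dataR => _ _ []. Qed.
Let RT2 : R2 \o T2 = G2. Proof. by case: dataR => _ _ _ []. Qed.
Let TR2 : T2 \o R2 = E.2. Proof. by case: dataR => _ _ _ []. Qed.
Let RTR2 : R2 \o T2 \o R2 = R2. Proof. by case: dataR => _ _ _ []. Qed.

Let commute_R1 X : lin X -> legs_commute X T1 -> legs_commute X E.1 -> legs_commute X R1.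
Proof.
move=> Xl XT XE; apply: (legs_commute_inverse_r R1l T1l RTR1) => //.
  by rewrite TR1.
by rewrite RT1; apply: (commute_G1 C GS1).
Qed.

Let commute_R2 X : lin X -> legs_commute T2 X -> legs_commute E.2 X -> legs_commute R2 X.
Proof.
move=> Xl XT XE; apply: (legs_commute_inverse_l R2l T2l RTR2) => //.
  by rewrite TR2.
by rewrite RT2; apply: legs_commute_G2.
Qed.

Let T2R1 : legs_commute T2 R1.
Proof. by apply: commute_R1 => //; [exact: coreT2T1 C|exact: coreT2E1 C]. Qed.

Let R2T1 : legs_commute R2 T1.
Proof. by apply: commute_R2 => //; [exact: coreT2T1 C|exact: coreE2T1 C]. Qed.

Let R2R1 : legs_commute R2 R1.
Proof.
apply: commute_R1 => //; apply: commute_R2 => //; [exact: coreT2E1 C|exact: coreE2E1 C].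
Qed.

Let flipR1 : [/\ forall t, flip R2 (flip T2 t) = flip G2 t,
   forall t, flip T2 (flip R2 t) = flip E.2 t
 & forall t, flip R2 (flip T2 (flip R2 t)) = flip R2 t].
Proof.
split=> t; rewrite /flip !twK.
- by rewrite -RT2.
- by rewrite -TR2.
- by rewrite -[in RHS]RTR2.
Qed.

(** Both sides equal the product of the three legs of (R_2 (x) id)(id (x) R_1)(c (x) a (x) b).
    [counit_R1] with E_2 = T_2 R_2 treats the left side, its mirror image with E_1 = T_1 R_1 the
    right side, and the commutation of R_2 with R_1 joins them. *)
Lemma antipode_multiplier a b c :
  mul c (epsl eps (R1 (tens a b))) = mul (epsr eps (R2 (tens c a))) b.
Proof.
have /funeqP pRT1 := RT1; have /funeqP pRTR1 := RTR1.
have /funeqP pTR2 := TR2; have /funeqP pTR1 := TR1.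
have [fRT fTR fRTR] := flipR1.
rewrite (counit_R1 C GS1 pRT1 pRTR1).
have := counit_R1 C' GS2 fRT fRTR a c b.
rewrite flip_tens epsl_tw // tlift_tw; last first.
  by have := lin_flip E1l; linear_tac.
move=> ->.
transitivity (tlift (fun x y => tlift (fun p q => mul (mul p q) y) (R2 (tens c x)))
    (R1 (tens a b))).
  apply: eq_tlift => x y; rewrite -(pTR2 (tens c x)) (core_counit2 C) /tmu.
  exact: (lin_through _ _ (ml y)).
rewrite (legs_commuteE R2l R1l R2R1 (H := fun p q y => mul (mul p q) y)); last first.
  by split; linear_tac.
apply: eq_tlift => p q; rewrite flip_tens epsr_tw // -(pTR1 (tens q b)).
rewrite (core_counit1 C) /tmu (lin_through _ _ (mr p)).
by apply: eq_tlift => x y; rewrite mA.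
Qed.

Definition antipode (a : A) : mult A :=
  (fun b => epsl eps (R1 (tens a b)), fun b => epsr eps (R2 (tens b a))).

Lemma antipode_data_S : data_S mul E Delta T1 T2 antipode.
Proof.
have /funeqP pRTR1 := RTR1; have /funeqP pTR1 := TR1.
have [fRT fTR fRTR] := flipR1.
split.
- split=> [a|]; split=> /=; rewrite /antipode /=; try by linear_tac.
  by move=> b c; exact: antipode_multiplier.
- by move=> a b c; exact: (R1_axvii C R1l pTR1).
(* (viii) is (vii) for the opposite structure, read through the twist. *)
- move=> a b c; have R2l' := lin_flip R2l.
  have := R1_axvii C' R2l' fTR c b a (legs_commute_flip R2l T1l R2T1).
  rewrite [flip T2 _]/flip !flip_tens => /(congr1 (@tw k A A)); rewrite !twK => <-.
  congr T2; rewrite tlift_tw; last by linear_tac.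
  rewrite (lin_through _ _ (@lin_tw k A A)); apply: eq_tlift => x y.
  by rewrite flip_tens epsl_tw // twE.
- by move=> a d; exact: (R1_axix C R1l pTR1 pRTR1).
Qed.
End FromData.

(** For each index, R' = R' T R' = G R' = R T R' = R E = R T R = R. *)
Lemma data_R_unique (R R' : (tensor A A -> tensor A A) * (tensor A A -> tensor A A)) :
  data_R E T1 T2 G1 G2 R -> data_R E T1 T2 G1 G2 R' -> R = R'.
Proof.
case: R R' => R1 R2 [R1' R2'] [_ _ [/= a1 b1 c1] [a2 b2 c2]] [_ _ [/= a1' b1' c1'] [a2' b2' c2']].
congr pair.
  by rewrite -c1' a1' -a1 -[R1 \o T1 \o R1']/(R1 \o (T1 \o R1')) b1' -b1 compA.
by rewrite -c2' a2' -a2 -[R2 \o T2 \o R2']/(R2 \o (T2 \o R2')) b2' -b2 compA.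
Qed.

Section FromAntipode.
Variable S : A -> mult A.
Hypothesis dataS : data_S mul E Delta T1 T2 S.

Let S1l : forall y, lin (fun x => (S x).1 y). Proof. by case: dataS => -[_ []]. Qed.
Let S2l : forall y, lin (fun x => (S x).2 y). Proof. by case: dataS => -[_ []]. Qed.
Let S1r x : lin (S x).1. Proof. by case: dataS => -[/(_ x)[]]. Qed.
Let S2r x : lin (S x).2. Proof. by case: dataS => -[/(_ x)[]]. Qed.
Let Smult a b c : mul b ((S a).1 c) = mul ((S a).2 b) c.
Proof. by case: dataS => -[/(_ a)[]]. Qed.

Lemma data_R_exists : exists R, data_R E T1 T2 G1 G2 R.
Proof.
have [_ vii viii _] := dataS.
have [R1 [R1l RT1 TR1 RTR1]] := R1_exists C S1l S1r Smult vii viii GS1.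
(* In the opposite structure the two actions of S are exchanged, and so are (vii) and (viii). *)
have vii' a b c : flip T2 (tlift (fun x y => tens x ((S y).2 c)) (flip T1 (tens a b))) =
    flip (Delta a).2 (tens b c).
  rewrite !flip_tens -viii /flip; congr (tw (T2 _)).
  rewrite tlift_tw; last by linear_tac.
  rewrite (lin_through _ _ (@lin_tw k A A)); apply: eq_tlift => x y.
  by rewrite twE.
have viii' a b c : flip T1 (tlift (fun x y => tens ((S x).1 a) y) (flip T2 (tens b c))) =
    flip (Delta c).1 (tens a b).
  rewrite !flip_tens -vii /flip; congr (tw (T1 _)).
  rewrite tlift_tw; last by linear_tac.
  rewrite (lin_through _ _ (@lin_tw k A A)); apply: eq_tlift => x y.
  by rewrite twE.
have Smult' a b c : mul ((S a).2 c) b = mul c ((S a).1 b) by rewrite Smult.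
have [R2 [R2l RT2 TR2 RTR2]] :=
  R1_exists C' S2l S2r Smult' vii' viii' GS2.
exists (R1, flip R2); split=> /=.
- by [].
- exact: lin_flip.
- by split; apply/funext => t /=.
have twI := can_inj (@twK k A A).
split; apply/funext => t /=.
- by apply: twI; have := RT2 (tw t); rewrite /flip !twK.
- by apply: twI; have := TR2 (tw t); rewrite /flip !twK.
- by rewrite /flip; congr tw; exact: RTR2 (tw t).
Qed.
End FromAntipode.

Lemma data_S_unique (S S' : A -> mult A) :
  data_S mul E Delta T1 T2 S -> data_S mul E Delta T1 T2 S' -> S = S'.
Proof.
move=> dS dS'.
have half (U : A -> mult A) : data_S mul E Delta T1 T2 U -> forall c a d z,
    T1 z = E.1 (tens a d) ->
    mul c ((U a).1 d) = tlift (fun p q => epsr eps ((Delta q).2 (tens c p))) z.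
  move=> [[Um [Ul1 Ul2]] _ viii ix] c a d z Tz.
  have h := antipode_left_action C (S1 := fun x => (U x).1) Ul1 _ _ viii ix c.
  by apply: h Tz => [x|x b e]; case: (Um x).
have S1E a d : (S a).1 d = (S' a).1 d.
  apply: (nondegenerate_cancell bm (coreN C)) => c.
  (* The preimage [z] is produced by (vii) for S, but [half] evaluates both antipodes on the same
     [z]. *)
  have [_ vii _ _] := dS.
  have [z Tz] := E1_image C (S1 := fun x => (S x).1) vii (tens a d).
  by rewrite (half S dS c a d z Tz) (half S' dS' c a d z Tz).
have mS (U : A -> mult A) : data_S mul E Delta T1 T2 U ->
    forall a b c, mul b ((U a).1 c) = mul ((U a).2 b) c.
  by move=> [[Um _] _ _ _] a; case: (Um a).
apply/funext => a; rewrite [S a]surjective_pairing [S' a]surjective_pairing.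
congr pair; apply/funext => b; first exact: S1E.
by apply: (nondegenerate_cancelr bm (coreN C)) => c; rewrite -(mS S dS) -(mS S' dS') S1E.
Qed.
End TwoSides.

(** * From the axioms to the core identities *)

Lemma span_ind (k : fieldType) (W : lmodType k) (X M : W -> Prop) :
  subspace M -> (forall w, X w -> M w) -> forall w, Defs.span X w -> M w.
Proof.
move=> [M0 Ml] XM w [s [sX ->]]; elim: s sX => [|p s IH] sX.
  by rewrite big_nil.
rewrite big_cons; apply: Ml; first by apply/XM/sX; rewrite mem_head.
by apply: IH => q qs; apply: sX; rewrite in_cons qs orbT.
Qed.

Lemma mem_span (k : fieldType) (W : lmodType k) (X : W -> Prop) w :
  X w -> Defs.span X w.
Proof.
move=> Xw; exists [:: (1, w)]; split; last by rewrite big_seq1 scale1r.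
by move=> p; rewrite inE => /eqP ->.
Qed.

Section Core.
Variables (k : fieldType) (A : lmodType k) (mul : A -> A -> A)
  (E : mult (tensor A A)) (Delta : A -> mult (tensor A A)) (eps : A -> k^o)
  (T1 T2 T3 T4 : tensor A A -> tensor A A).
Notation AA := (tensor A A).
Notation AAA := (tensor (tensor A A) A).

Section Facts.
Hypotheses (algM : nu_algebra mul) (nd : Defs.nondegenerate mul).
Hypotheses (Em : is_mult (mul2 mul) E) (EE : mmul E E = E)
  (Dm : forall a, is_mult (mul2 mul) (Delta a)) (Dlin : mlin Delta)
  (Dmul : forall a b, Delta (mul a b) = mmul (Delta a) (Delta b)) (el : lin eps).
Hypotheses (T1l : lin T1) (T2l : lin T2).
Hypotheses
  (T1E : forall a b, memb (mul2 mul) (T1 (tens a b)) = mmul (Delta a) (one_t mul b))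
  (T2E : forall a b, memb (mul2 mul) (T2 (tens a b)) = mmul (t_one mul a) (Delta b))
  (T3E : forall a b, memb (mul2 mul) (T3 (tens a b)) = mmul (one_t mul b) (Delta a))
  (T4E : forall a b, memb (mul2 mul) (T4 (tens a b)) = mmul (Delta b) (t_one mul a)).
Hypotheses (counit1 : epsl eps \o T1 = tmu mul) (counit2 : epsr eps \o T2 = tmu mul).
Hypotheses
  (span1 : same_set (Defs.span (fun z => exists a b b', z = (Delta a).1 (tens b b')))
                    (Defs.span (fun z => exists b b', z = E.1 (tens b b'))))
  (span2 : same_set (Defs.span (fun z => exists a b b', z = (Delta a).2 (tens b b')))
                    (Defs.span (fun z => exists b b', z = E.2 (tens b b')))).

Let bm : bil mul. Proof. exact: nu_algebra_bil algM. Qed.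
Let mr : forall a, lin (mul a). Proof. by case: bm. Qed.
Let ml : forall a, lin (fun x => mul x a). Proof. by case: bm. Qed.
Let mA : associative mul. Proof. by case: algM. Qed.
Let E1l : lin E.1. Proof. by case: Em. Qed.
Let E2l : lin E.2. Proof. by case: Em. Qed.
Let EM x y : mul2 mul x (E.1 y) = mul2 mul (E.2 x) y. Proof. by case: Em. Qed.
Let D1l a : lin (Delta a).1. Proof. by case: (Dm a). Qed.
Let D2l a : lin (Delta a).2. Proof. by case: (Dm a). Qed.
Let DM a x y : mul2 mul x ((Delta a).1 y) = mul2 mul ((Delta a).2 x) y.
Proof. by case: (Dm a). Qed.
Let bm2 : bil (mul2 mul). Proof. exact: bil_mul2. Qed.
Let m2A : associative (mul2 mul). Proof. exact: tmulA. Qed.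
Let nd2 : Defs.nondegenerate (mul2 mul). Proof. exact: tmul_nondegenerate. Qed.

Let cancell (x y : AA) : (forall z, mul2 mul z x = mul2 mul z y) -> x = y.
Proof. exact: (nondegenerate_cancell bm2 nd2). Qed.
Let cancelr (x y : AA) : (forall z, mul2 mul x z = mul2 mul y z) -> x = y.
Proof. exact: (nondegenerate_cancelr bm2 nd2). Qed.

Let idm : is_mult mul (mone A). Proof. exact: mone_is_mult. Qed.
Let onem b : is_mult (mul2 mul) (one_t mul b).
Proof. exact: (tmul_is_mult bm bm idm (memb_is_mult bm mA b)). Qed.
Let tonem b : is_mult (mul2 mul) (t_one mul b).
Proof. exact: (tmul_is_mult bm bm (memb_is_mult bm mA b) idm). Qed.

Let pull1 X x y : is_mult (mul2 mul) X -> X.1 (mul2 mul x y) = mul2 mul (X.1 x) y.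
Proof. exact: mult_mull. Qed.
Let pull2 X x y : is_mult (mul2 mul) X -> X.2 (mul2 mul x y) = mul2 mul x (X.2 y).
Proof. exact: mult_mulr. Qed.

(** The maps T_i are known through their embedding into the multipliers. These eight lemmas give
    their products with a test element [y]; the identities below are obtained by multiplying with
    [y] and cancelling. *)
Lemma T1_mull a b y : mul2 mul (T1 (tens a b)) y = (Delta a).1 (tmap id (mul b) y).
Proof. exact: (congr1 (fun X => X.1 y) (T1E a b)). Qed.
Lemma T1_mulr a b y : mul2 mul y (T1 (tens a b)) = tmap id (mul^~ b) ((Delta a).2 y).
Proof. exact: (congr1 (fun X => X.2 y) (T1E a b)). Qed.
Lemma T2_mull a b y : mul2 mul (T2 (tens a b)) y = tmap (mul a) id ((Delta b).1 y).
Proof. exact: (congr1 (fun X => X.1 y) (T2E a b)). Qed.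
Lemma T2_mulr a b y : mul2 mul y (T2 (tens a b)) = (Delta b).2 (tmap (mul^~ a) id y).
Proof. exact: (congr1 (fun X => X.2 y) (T2E a b)). Qed.
Lemma T3_mull a b y : mul2 mul (T3 (tens a b)) y = tmap id (mul b) ((Delta a).1 y).
Proof. exact: (congr1 (fun X => X.1 y) (T3E a b)). Qed.
Lemma T3_mulr a b y : mul2 mul y (T3 (tens a b)) = (Delta a).2 (tmap id (mul^~ b) y).
Proof. exact: (congr1 (fun X => X.2 y) (T3E a b)). Qed.
Lemma T4_mull a b y : mul2 mul (T4 (tens a b)) y = (Delta b).1 (tmap (mul a) id y).
Proof. exact: (congr1 (fun X => X.1 y) (T4E a b)). Qed.
Lemma T4_mulr a b y : mul2 mul y (T4 (tens a b)) = tmap (mul^~ a) id ((Delta b).2 y).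
Proof. exact: (congr1 (fun X => X.2 y) (T4E a b)). Qed.

(** By (iv) the elements Delta(a)(b (x) c) lie in the span of the E(b (x) b'), which E fixes because
    it is idempotent. *)
Lemma E1_Delta a y : E.1 ((Delta a).1 y) = (Delta a).1 y.
Proof.
have EE1 z : E.1 (E.1 z) = E.1 z by exact: (congr1 (fun X => X.1 z) EE).
move: y; apply: tensor_ext => [||b c]; [exact: (lin_comp E1l (D1l a))|exact: D1l|].
apply: (@span_ind _ _ (fun z => exists b b', z = E.1 (tens b b'))
         (fun z => E.1 z = z)).
- by split; [exact: lin0|move=> c' x y xE yE; rewrite E1l xE yE].
- by move=> w [x [y ->]]; exact: EE1.
- by apply/span1/mem_span; exists a, b, c.
Qed.

Lemma E2_Delta a y : E.2 ((Delta a).2 y) = (Delta a).2 y.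
Proof.
have EE2 z : E.2 (E.2 z) = E.2 z by exact: (congr1 (fun X => X.2 z) EE).
move: y; apply: tensor_ext => [||b c]; [exact: (lin_comp E2l (D2l a))|exact: D2l|].
apply: (@span_ind _ _ (fun z => exists b b', z = E.2 (tens b b'))
         (fun z => E.2 z = z)).
- by split; [exact: lin0|move=> c' x y xE yE; rewrite E2l xE yE].
- by move=> w [x [y ->]]; exact: EE2.
- by apply/span2/mem_span; exists a, b, c.
Qed.

(** The multiplier identities move both Delta(a) and E to the other factor, where [E2_Delta]
    applies. *)
Lemma Delta_E1 a y : (Delta a).1 (E.1 y) = (Delta a).1 y.
Proof. by apply: cancell => z; rewrite !DM EM E2_Delta. Qed.

Lemma Delta_E2 a y : (Delta a).2 (E.2 y) = (Delta a).2 y.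
Proof. by apply: cancelr => z; rewrite -!DM -EM E1_Delta. Qed.

Lemma E1_T1 t : E.1 (T1 t) = T1 t.
Proof.
move: t; apply: tensor_ext; [linear_tac..|move=> a b].
by apply: cancelr => y; rewrite -pull1 // T1_mull E1_Delta.
Qed.

Lemma E2_T2 t : E.2 (T2 t) = T2 t.
Proof.
move: t; apply: tensor_ext; [linear_tac..|move=> a b].
by apply: cancell => y; rewrite -pull2 // T2_mulr E2_Delta.
Qed.

Lemma E1_T4 a b : E.1 (T4 (tens a b)) = T4 (tens a b).
Proof. by apply: cancelr => y; rewrite -pull1 // T4_mull E1_Delta. Qed.

Lemma E2_T3 a b : E.2 (T3 (tens a b)) = T3 (tens a b).
Proof. by apply: cancell => y; rewrite -pull2 // T3_mulr E2_Delta. Qed.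

Lemma DeltaM1 a b y : (Delta (mul a b)).1 y = (Delta a).1 ((Delta b).1 y).
Proof. by rewrite Dmul. Qed.

Lemma DeltaM2 a b y : (Delta (mul a b)).2 y = (Delta b).2 ((Delta a).2 y).
Proof. by rewrite Dmul. Qed.

Lemma T1_mul_left a t : T1 (tmap (mul a) id t) = (Delta a).1 (T1 t).
Proof.
move: t; apply: tensor_ext; [linear_tac..|move=> p q]; rewrite tmapE //.
by apply: cancelr => y; rewrite -pull1 // !T1_mull DeltaM1.
Qed.

Lemma T2_mul_right a t : T2 (tmap id (mul^~ a) t) = (Delta a).2 (T2 t).
Proof.
move: t; apply: tensor_ext; [linear_tac..|move=> p q]; rewrite tmapE //.
by apply: cancell => y; rewrite -pull2 // !T2_mulr DeltaM2.
Qed.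

Lemma T1_mul_right p q d : T1 (tens p (mul q d)) = tmap id (mul^~ d) (T1 (tens p q)).
Proof.
apply: cancell => y; rewrite -(pull2 _ _ (onem d)) /= !T1_mulr tmap_id_comp //.
by congr tmap; apply/funext => x /=; rewrite mA.
Qed.

Lemma T2_mul_left p q d : T2 (tens (mul d q) p) = tmap (mul d) id (T2 (tens q p)).
Proof.
apply: cancelr => y; rewrite -(pull1 _ _ (tonem d)) /= !T2_mull tmap_id_comp //.
by congr tmap; apply/funext => x /=; rewrite mA.
Qed.

(** Both sides are (a (x) 1) Delta(p) (1 (x) t), bracketed differently; the next two lemmas are of
    the same kind. *)
Lemma T1_T2_mixed a p t :
  tmap (mul a) id (T1 (tens p t)) = tmap id (mul^~ t) (T2 (tens a p)).
Proof.
apply: cancelr => y; rewrite -(pull1 _ _ (tonem a)) /= T1_mull.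
by have [_ _ <-] := onem t; rewrite T2_mull.
Qed.

Lemma T2_T4_mixed c d b :
  tmap (mul c) id (T4 (tens d b)) = tmap (mul^~ d) id (T2 (tens c b)).
Proof.
apply: cancelr => y; rewrite -(pull1 _ _ (tonem c)) /= T4_mull.
by have [_ _ <-] := tonem d; rewrite T2_mull.
Qed.

Lemma T1_T3_mixed c d b :
  tmap id (mul^~ c) (T3 (tens b d)) = tmap id (mul d) (T1 (tens b c)).
Proof.
apply: cancell => y; rewrite -(pull2 _ _ (onem c)) /= T3_mulr.
by have [_ _ ->] := onem d; rewrite T1_mulr.
Qed.

(** Multiplying by c on the left replaces T_4 by T_2, for which the counit axiom is available. *)
Lemma epsr_T4 d b : epsr eps (T4 (tens d b)) = mul b d.
Proof.
apply: (nondegenerate_cancell bm nd) => c.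
transitivity (epsr eps (tmap (mul c) id (T4 (tens d b)))).
  rewrite /epsr tlift_tmap; last by linear_tac.
  by rewrite (lin_through _ _ (mr c)); apply: eq_tlift => x y; rewrite (linZ (mr c)).
rewrite T2_T4_mixed /epsr tlift_tmap; last by linear_tac.
transitivity (mul (epsr eps (T2 (tens c b))) d).
  rewrite /epsr (lin_through _ _ (ml d)); apply: eq_tlift => x y.
  by rewrite (linZ (ml d)).
by rewrite [X in mul X d](congr1 (fun f => f (tens c b)) counit2) /tmu tliftE // mA.
Qed.

Lemma epsl_T3 b d : epsl eps (T3 (tens b d)) = mul d b.
Proof.
apply: (nondegenerate_cancelr bm nd) => c.
transitivity (epsl eps (tmap id (mul^~ c) (T3 (tens b d)))).
  rewrite /epsl tlift_tmap; last by linear_tac.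
  by rewrite (lin_through _ _ (ml c)); apply: eq_tlift => x y; rewrite (linZ (ml c)).
rewrite T1_T3_mixed /epsl tlift_tmap; last by linear_tac.
transitivity (mul d (epsl eps (T1 (tens b c)))).
  rewrite /epsl (lin_through _ _ (mr d)); apply: eq_tlift => x y.
  by rewrite (linZ (mr d)).
by rewrite [X in mul d X](congr1 (fun f => f (tens b c)) counit1) /tmu tliftE // mA.
Qed.

(** Both sides are (id (x) eps)(Delta(y) Delta(b) (d (x) 1)): the left by expanding T_4, the right
    by multiplicativity of Delta and [epsr_T4]. *)
Lemma T1_T4_counit y b d :
  tlift (fun s t => mul (epsr eps (T1 (tens y t))) s) (T4 (tens d b)) =
  mul (mul y b) d.
Proof.
transitivity (epsr eps ((Delta y).1 (T4 (tens d b)))).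
  rewrite (lin_expand (f := fun w => epsr eps ((Delta y).1 w))); last by linear_tac.
  apply: eq_tlift => s t.
  (* Delta(y)(s (x) t) = T_1(y (x) t)(s (x) 1). *)
  have <- : tmap (mul^~ s) id (T1 (tens y t)) = (Delta y).1 (tens s t).
    apply: cancell => z; rewrite -(pull2 _ _ (tonem s)) /= T1_mulr tmap_id_comp //.
    by rewrite DM mul2_tensr.
  rewrite {2}/epsr tlift_tmap; last by linear_tac.
  by rewrite (lin_through _ _ (ml s)); apply: eq_tlift => u v; rewrite (linZ (ml s)).
rewrite -epsr_T4; congr (epsr eps _).
by apply: cancelr => z; rewrite -pull1 // !T4_mull DeltaM1.
Qed.

Lemma T2_T3_counit y b d :
  tlift (fun s t => mul t (epsl eps (T2 (tens s y)))) (T3 (tens b d)) =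
  mul d (mul b y).
Proof.
transitivity (epsl eps ((Delta y).2 (T3 (tens b d)))).
  rewrite (lin_expand (f := fun w => epsl eps ((Delta y).2 w))); last by linear_tac.
  apply: eq_tlift => s t.
  have <- : tmap id (mul t) (T2 (tens s y)) = (Delta y).2 (tens s t).
    apply: cancelr => z; rewrite -(pull1 _ _ (onem t)) /= T2_mull tmap_id_comp //.
    by rewrite -DM mul2_tensl.
  rewrite {2}/epsl tlift_tmap; last by linear_tac.
  by rewrite (lin_through _ _ (mr t)); apply: eq_tlift => u v; rewrite (linZ (mr t)).
rewrite -epsl_T3; congr (epsl eps _).
by apply: cancell => z; rewrite -pull2 // !T3_mulr DeltaM2.
Qed.

Let bm3 : bil (mul3 mul). Proof. exact: bil_tmul. Qed.
Let m3A : associative (mul3 mul). Proof. exact: tmulA. Qed.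
Let nd3 : Defs.nondegenerate (mul3 mul). Proof. exact: tmul_nondegenerate. Qed.

Lemma mul3E s c t d :
  mul3 mul (tens s c) (tens t d) = tens (mul2 mul s t) (mul c d).
Proof. exact: (tmulE bm2 bm). Qed.

(** The associator is multiplicative, so multipliers of A (x) (A (x) A) can be transported to the
    other bracketing; [ml_is_mult] relies on this. *)
Lemma mul3_assocR x y : mul3 mul (assocR x) (assocR y) =
  assocR (tmul mul (mul2 mul) x y).
Proof.
have b3 := bm3; have b3' := bil_tmul bm bm2.
move: x; apply: (tensor_ext (f := fun x => mul3 mul (assocR x) (assocR y))
  (g := fun x => assocR (tmul mul (mul2 mul) x y))); [linear_tac..|move=> a s].
move: y; apply: (tensor_ext (f := fun y => mul3 mul (assocR (tens a s)) (assocR y))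
  (g := fun y => assocR (tmul mul (mul2 mul) (tens a s) y))); [linear_tac..|move=> b t].
rewrite tmulE //.
move: s; apply: (tensor_ext (f := fun s => mul3 mul (assocR (tens a s)) (assocR (tens b t)))
  (g := fun s => assocR (tens (mul a b) (mul2 mul s t)))); [linear_tac..|move=> c d].
move: t; apply: (tensor_ext
  (f := fun t => mul3 mul (assocR (tens a (tens c d))) (assocR (tens b t)))
  (g := fun t => assocR (tens (mul a b) (mul2 mul (tens c d) t)))); [linear_tac..|move=> e f].
by rewrite mul2E // !assocR_tens mul3E mul2E.
Qed.

Lemma ml_is_mult n X : is_mult mul n -> is_mult (mul2 mul) X ->
  is_mult (mul3 mul) (Defs.ml n X).
Proof.
move=> nm Xm; have [n1 n2 _] := nm; have [X1 X2 _] := Xm.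
have [_ _ M] := tmul_is_mult bm bm2 nm Xm.
split=> [||s t]; rewrite /Defs.ml /comp /=; [linear_tac..|].
by rewrite -{1}[s]assocLK mul3_assocR M -mul3_assocR assocLK.
Qed.

Lemma mr_is_mult X n : is_mult (mul2 mul) X -> is_mult mul n ->
  is_mult (mul3 mul) (Defs.mr X n).
Proof. by move=> Xm nm; apply: (tmul_is_mult bm2 bm). Qed.

(** Right multiplication by E (x) 1 and left multiplication by 1 (x) E commute by associativity. *)
Lemma E2_E1_legs : legs_commute E.2 E.1.
Proof.
apply/funext => t; have mE := mr_is_mult Em idm; have Em' := ml_is_mult idm Em.
exact: (mult_sides_commute bm3 m3A nd3 t mE Em').
Qed.

(** * Consequences of (v): E commutes with T_1 and T_2 on overlapping legs *)

Section Coproduct.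
Hypotheses (EEc : mmul (Defs.mr E (mone A)) (Defs.ml (mone A) E) =
                  mmul (Defs.ml (mone A) E) (Defs.mr E (mone A))).
Variables (gb gb' : mult AA -> mult AAA).
Hypotheses
  (ext : is_extension (mul2 mul) (mul3 mul) (id_Delta mul Delta) (Defs.ml (mone A) E) gb)
  (gbE : gb E = mmul (Defs.mr E (mone A)) (Defs.ml (mone A) E))
  (ext' : is_extension (mul2 mul) (mul3 mul) (Delta_id mul Delta) (Defs.mr E (mone A)) gb')
  (gbE' : gb' E = mmul (Defs.mr E (mone A)) (Defs.ml (mone A) E)).

Lemma tmap_assocR_right (f : A -> A) (u : A) (s : AA) : lin f ->
  tmap id f (assocR (tens u s)) = assocR (tens u (tmap id f s)).
Proof.
move=> fl; move: s; apply: (tensor_ext (f := fun s => tmap id f (assocR (tens u s)))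
  (g := fun s => assocR (tens u (tmap id f s)))); [linear_tac..|move=> b c].
by rewrite tmapE // !assocR_tens tmapE.
Qed.

Lemma tmap_assocR_left (f : A -> A) (u : A) (s : AA) : lin f ->
  tmap (tmap f id) id (assocR (tens u s)) = assocR (tens (f u) s).
Proof.
move=> fl; move: s; apply: (tensor_ext (f := fun s => tmap (tmap f id) id (assocR (tens u s)))
  (g := fun s => assocR (tens (f u) s))); [linear_tac..|move=> b c].
by rewrite !assocR_tens !tmapE //; linear_tac.
Qed.

Let Dlin1 : forall y, lin (fun x => (Delta x).1 y). Proof. by case: Dlin. Qed.
Let Dlin2 : forall y, lin (fun x => (Delta x).2 y). Proof. by case: Dlin. Qed.

Lemma bil_id_Delta y :
  bil (fun a b => assocR (tmap (mul^~ a) (Delta b).2 (@assocL k A A A y))).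
Proof. by rewrite /tmap; linear_tac. Qed.

Lemma bil_Delta_id y : bil (fun a b => tmap (Delta a).1 (mul b) y).
Proof. by rewrite /tmap; linear_tac. Qed.

Lemma id_Delta_tens a b y : (id_Delta mul Delta (tens a b)).2 y =
  assocR (tmap (mul^~ a) (Delta b).2 (assocL y)).
Proof. exact: (tliftE _ _ (bil_id_Delta y)). Qed.

Lemma Delta_id_tens a b y : (Delta_id mul Delta (tens a b)).1 y =
  tmap (Delta a).1 (mul b) y.
Proof. exact: (tliftE _ _ (bil_Delta_id y)). Qed.

Lemma lin_id_Delta y : lin (fun t => (id_Delta mul Delta t).2 y).
Proof. exact: (lin_tlift (bil_id_Delta y)). Qed.

Lemma lin_Delta_id y : lin (fun t => (Delta_id mul Delta t).1 y).
Proof. exact: (lin_tlift (bil_Delta_id y)). Qed.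

(** (id (x) T_1)(t (x) c) is (id (x) Delta)(t) times 1 (x) 1 (x) c, so facts about the extension of
    id (x) Delta become facts about T_1. [T2_Delta_id] is the counterpart for T_2. *)
Lemma id_Delta_T1 y t c : mul3 mul y (leg23 T1 (tens t c)) =
  tmap id (mul^~ c) ((id_Delta mul Delta t).2 y).
Proof.
have lt := lin_bil_l c (bil_tens (tensor A A) A).
move: t; apply: tensor_ext => [||a b].
- exact: lin_comp (bm3.1 y) (lin_comp (lin_leg23 T1l) lt).
- by apply: lin_comp (lin_id_Delta y); linear_tac.
have lE : lin (fun y => tmap id (mul^~ c) (assocR (tmap (mul^~ a) (Delta b).2
    (@assocL k A A A y)))) by linear_tac.
rewrite id_Delta_tens; move: y; apply: tensor3_ext; [linear_tac..|move=> y1 y2 y3].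
rewrite -[tens (tens y1 y2) y3]assocR_tens /leg23 /= assocLE tmapE //.
rewrite mul3_assocR tmulE // T1_mulr assocR_tens assocLE tmapE //.
by rewrite tmap_assocR_right.
Qed.

Lemma T2_Delta_id x t y :
  mul3 mul (leg12 T2 (assocR (tens x t))) y =
  tmap (tmap (mul x) id) id ((Delta_id mul Delta t).1 y).
Proof.
move: t; apply: tensor_ext => [||a b].
- apply: lin_comp (bm3.2 y) (lin_comp (lin_leg12 T2l) _).
  by apply: lin_comp (@lin_assocR k A A A) ((bil_tens _ _).1 x).
- by apply: lin_comp (lin_Delta_id y); linear_tac.
rewrite assocR_tens /leg12 tmapE // Delta_id_tens.
move: y; apply: tensor_ext; [linear_tac..|move=> y z].
rewrite mul3E !tmapE //; last by linear_tac.
by rewrite T2_mull.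
Qed.

(** (id (x) Delta)(t E) = (id (x) Delta)(t) E^(3) = (id (x) Delta)(t)(1 (x) E)(E (x) 1), and the
    factor 1 (x) E is absorbed because Delta(b) E = Delta(b). *)
Lemma id_Delta_E2 t y :
  (id_Delta mul Delta (E.2 t)).2 y = leg12 E.2 ((id_Delta mul Delta t).2 y).
Proof.
have [_ gbM _ gbm] := ext.
rewrite -(gbm (E.2 t)) (memb_multr bm2 m2A nd2 t Em).
rewrite gbM //; last exact: memb_is_mult.
rewrite gbE EEc gbm; congr (leg12 E.2 _); rewrite -/(leg23 E.2 _).
have lE := lin_leg23 E2l; have lD := lin_id_Delta.
move: t; apply: tensor_ext; [linear_tac..|move=> a b].
rewrite id_Delta_tens /leg23 /= assocRK tmap_id_comp //.
by congr (assocR (tmap _ _ _)); apply/funext => z /=; rewrite E2_Delta.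
Qed.

Lemma Delta_id_E1 t y :
  (Delta_id mul Delta (E.1 t)).1 y = leg23 E.1 ((Delta_id mul Delta t).1 y).
Proof.
have [_ gbM _ gbm] := ext'.
rewrite -(gbm (E.1 t)) (memb_multl bm2 m2A nd2 t Em).
rewrite gbM //; last exact: memb_is_mult.
rewrite gbE' EEc gbm; congr (leg23 E.1 _); rewrite -/(leg12 E.1 _).
have lE := lin_leg12 E1l; have lD := lin_Delta_id.
move: t; apply: tensor_ext; [linear_tac..|move=> a b].
rewrite Delta_id_tens /leg12 /= tmap_id_comp //.
by congr (tmap _ _ _); apply/funext => z /=; rewrite E1_Delta.
Qed.

(** After multiplication by y on the left, [id_Delta_T1] reduces the claim to [id_Delta_E2] and to
    the fact that E (x) 1 commutes with 1 (x) 1 (x) c. *)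
Lemma E2_T1_legs : legs_commute E.2 T1.
Proof.
have lT := lin_leg23 T1l; have lE := lin_leg12 E2l.
apply/funext; apply: tensor_ext => [||t c] /=; [exact: lin_comp..|].
apply: (nondegenerate_cancell bm3 nd3) => y.
rewrite -(mult_mulr bm3 m3A nd3 y _ (mr_is_mult Em idm)) /= -/(leg12 E.2 _).
rewrite id_Delta_T1 /leg12 tmapE // id_Delta_T1 id_Delta_E2 /leg12.
by rewrite !tmap_id_comp //; linear_tac.
Qed.

Lemma T2_E1_legs : legs_commute T2 E.1.
Proof.
have lT := lin_leg12 T2l; have lE := lin_leg23 E1l.
apply/funext => w; rewrite -[w]assocLK; move: (assocL w) => {w}.
apply: tensor_ext => [||x t] /=; [linear_tac..|].
apply: (nondegenerate_cancelr bm3 nd3) => y.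
transitivity (tmap (tmap (mul x) id) id (leg23 E.1 ((Delta_id mul Delta t).1 y))).
  rewrite -Delta_id_E1 -T2_Delta_id; congr (mul3 mul (leg12 T2 _) y).
  by rewrite /leg23 /= assocRK tmapE.
(* Left multiplication by 1 (x) E commutes with left multiplication by x on the first leg. *)
transitivity (leg23 E.1 (mul3 mul (leg12 T2 (assocR (tens x t))) y)); last first.
  exact: (mult_mull bm3 m3A nd3 _ y (ml_is_mult idm Em)).
rewrite T2_Delta_id; move: ((Delta_id _ _ _).1 _) => z.
rewrite -[z]assocLK; move: (assocL z) => {}z.
move: z; apply: tensor_ext => [||a s]; [linear_tac..|].
by rewrite /leg23 /= !tmap_assocR_left // !assocRK !tmapE // tmap_assocR_left.
Qed.
End Coproduct.
End Facts.

Lemma regular_core : regular_wmb_bialgebra mul E Delta eps T1 T2 T3 T4 ->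
  core mul eps E.1 E.2 T1 T2 T3 T4 (fun a => (Delta a).1) (fun a => (Delta a).2).
Proof.
case=> [[[algM idem nd] [[Em EE] Dm Dlin Dmul el] [T1l T2l T1E T2E] coassoc
  [[cu1 cu2] [sp1 sp2] [E3 [[gb [ext gbE]] [gb' [ext' gbE']] E3E E3E']] _]]
  T3l T4l T3E T4E].
have bm := nu_algebra_bil algM; have mA : associative mul by case: algM.
have bm2 := bil_mul2 bm.
rewrite -E3E in gbE gbE' E3E'.
(* Turns the equality of spans in (iv) into the induction principle that [core] records for each
   side of E. *)
have E_in_span (X Y : AA -> Prop) (F : AA -> AA) : lin F -> same_set (Defs.span X) (Defs.span Y) ->
    (forall b c, Y (F (tens b c))) -> forall M, subspace M -> (forall t, X t -> M t) ->
    forall w, M (F w).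
  move=> Fl XY YF M subM XM w; rewrite (lin_expand w Fl) /tlift.
  elim: (tdecomp w) => [|p s IH]; first by rewrite big_nil; exact: subM.1.
  rewrite big_cons -[F _]scale1r; apply: subM.2 => //.
  by apply: (span_ind subM XM); apply/XY/mem_span/YF.
have [E1l E2l _] := Em.
split=> //.
- by split=> a; case: (Dm a).
- exact: (E2_T1_legs algM nd Em EE Dm Dlin T1l T1E sp2 E3E' ext gbE).
- exact: (T2_E1_legs algM nd Em EE Dm Dlin T2l T2E sp1 E3E' ext' gbE').
- exact: E2_E1_legs.
- by move=> t; exact: (congr1 (fun f => f t) cu1).
- by move=> t; exact: (congr1 (fun f => f t) cu2).
- exact: T1_T2_mixed.
- by apply: E1_T1.
- by apply: E2_T2.
- by apply: T1_T4_counit.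
- by apply: T2_T3_counit.
- move=> w d b; have [_ _ <-] := Em.
  by rewrite (E1_T4 algM nd Em EE Dm T4E sp1).
- move=> w b d; have [_ _ ->] := Em.
  by rewrite (E2_T3 algM nd Em EE Dm T3E sp2).
- by apply: T1_mul_left.
- by apply: T2_mul_right.
- by apply: Delta_E1.
- by apply: Delta_E2.
- by move=> b d w; rewrite (T4_mulr T4E).
- by move=> b d w; rewrite (T3_mull T3E).
- exact: T1_mul_right.
- exact: T2_mul_left.
- move=> M subM MD; apply: (E_in_span _ _ _ E1l sp1) => // [b c|t [a [b [c ->]]]] //.
  by exists b, c.
- move=> M subM MD; apply: (E_in_span _ _ _ E2l sp2) => // [b c|t [a [b [c ->]]]] //.
  by exists b, c.
Qed.

Lemma is_G1_spec G1 : bil mul -> lin eps -> lin T1 ->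
  is_G1 mul E eps T1 T4 G1 -> G1_spec mul eps T1 T4 G1.
Proof.
move=> bm el T1l [Gl GE]; split=> // a b d.
by rewrite GE tlift_tw //=; linear_tac.
Qed.

Lemma is_G2_spec G2 : bil mul -> lin eps -> lin T2 -> is_G2 mul E eps T2 T3 G2 ->
  G1_spec (fun a b => mul b a) eps (flip T2) (flip T3) (flip G2).
Proof.
move=> bm el T2l [Gl GE]; split=> [|a b d]; first exact: lin_flip.
have T2l' := lin_flip T2l.
rewrite !flip_tens tlift_tw; last by linear_tac.
rewrite GE tlift_tw /=; last by linear_tac.
rewrite (lin_through _ _ (@lin_tw k A A)); apply: eq_tlift => s t.
by rewrite twE flip_tens epsr_tw.
Qed.
End Core.

Theorem theorem6p8 (k : fieldType) (A : lmodType k) (mul : A -> A -> A)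
  (E : mult (tensor A A)) (Delta : A -> mult (tensor A A)) (eps : A -> k^o)
  (T1 T2 T3 T4 G1 G2 : tensor A A -> tensor A A) :
  regular_wmb_bialgebra mul E Delta eps T1 T2 T3 T4 ->
  is_G1 mul E eps T1 T4 G1 ->
  is_G2 mul E eps T2 T3 G2 ->
  exists f : {R : (tensor A A -> tensor A A) * (tensor A A -> tensor A A)
                | data_R E T1 T2 G1 G2 R}
             -> {S : A -> mult A | data_S mul E Delta T1 T2 S},
    bijective f.
Proof.
move=> H G1E G2E; have C := regular_core H.
have bm := nu_algebra_bil (coreM C); have el := coreEps C.
have [T1l T2l] := coreT C.
have GS1 := is_G1_spec bm el T1l G1E; have GS2 := is_G2_spec bm el T2l G2E.
have dataS (R : (tensor A A -> tensor A A) * (tensor A A -> tensor A A)) :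
    data_R E T1 T2 G1 G2 R -> data_S mul E Delta T1 T2 (antipode eps R.1 R.2).
  by case: R => R1 R2; exact: (antipode_data_S C GS1 GS2).
have dataR (S : {S : A -> mult A | data_S mul E Delta T1 T2 S}) :=
  cid (data_R_exists C GS1 GS2 (projT2 S)).
exists (fun R => exist _ _ (dataS (projT1 R) (projT2 R))).
(* The inverse chooses any R attached to S; both round trips then follow from uniqueness of each
   kind of data. *)
exists (fun S => exist _ _ (projT2 (dataR S))) => [[R HR]|[S HS]];
  apply: eq_exist => /=.
  exact: (data_R_unique (projT2 (dataR _)) HR).
exact: (data_S_unique C (dataS _ (projT2 (dataR _))) HS).
Qed.
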